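(* Let $G=PGL_3$ and $\tilde w\in\widetilde W$. (1) If $b=1$, then $X_{\tilde w}(b)\neq\emptyset$ if and only if one of the following holds: (a) $\tilde w=\mathrm{id}$; (b) $\tilde w\in\mathbb{O}_1$ or $\tilde w\in\mathbb{O}_2$; (c) $\tilde w\in\mathbb{C}_i$ or $\tilde w\in\mathbb{C}'_i$ for some $i\in\mathbb{N}_+$ with $\ell(\tilde w)\geq 6i+3$. (2) If $b=\tau$, then $X_{\tilde w}(b)\neq\emptyset$ if and only if one of the following holds: (a) $\tilde w\in\mathbb{O}_{id,\tau}$; (b) $\tilde w\in\mathbb{O}_{i,\tau}$ for some $i\in\mathbb{N}_+$ with $\ell(\tilde w)\geq 6i-1$; (c) $\tilde w\in\mathbb{O}_{1-i,\tau}$ for some $i\in\mathbb{N}_+$ with $\ell(\tilde w)\geq 6i+1$.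
   Context: $\mathbf{k}$ is an algebraic closure of $\mathbb{F}_q$, $L=\mathbf{k}((\epsilon))$, $F=\mathbb{F}_q((\epsilon))$; $G=PGL_3$ is split over $F$, $\sigma$ is the Frobenius on $G(L)$, $I\subset G(L)$ is a $\sigma$-stable Iwahori subgroup corresponding to the base alcove, and elements of the Iwahori–Weyl group $\widetilde W$ are identified with representatives in $G(L)$. $X_{\tilde w}(b)=\{gI\in G(L)/I\mid g^{-1}b\sigma(g)\in I\tilde wI\}$. $W=\langle s_1,s_2\rangle$ is the finite Weyl group of type $A_2$; $\alpha_1,\alpha_2$ are the simple roots, identified with the simple coroots ($\langle\alpha_i,\alpha_i\rangle=2$, $\langle\alpha_1,\alpha_2\rangle=-1$); $Q=\mathbb{Z}\alpha_1\oplus\mathbb{Z}\alpha_2$; $P$ is the coweight lattice; $\widetilde W=P\rtimes W$ with translations written $t^\lambda$. $W_a=Q\rtimes W$ is the Coxeter group generated by $s_0=t^{\alpha_1+\alpha_2}s_1s_2s_1$, $s_1$, $s_2$; $\widetilde W=W_a\rtimes\Omega$ with $\Omega=\langle\tau\rangle$, $\tau^3=1$, $\tau s_0\tau^{-1}=s_1$, $\tau s_1\tau^{-1}=s_2$, $\tau s_2\tau^{-1}=s_0$, i.e. $\tau=t^{(2\alpha_1+\alpha_2)/3}s_1s_2$. The length $\ell$ on $\widetilde W$ extends that of $W_a$, with $\ell(w\tau^j)=\ell(w)$ for $w\in W_a$. $\mathbb{N}_+$ is the set of positive integers. $\widetilde W$-conjugacy classes: $\mathbb{O}_1=\{t^{k\alpha_1}s_1,\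 t^{k\alpha_2}s_2,\ t^{k(\alpha_1+\alpha_2)}s_1s_2s_1\mid k\in\mathbb{Z}\}$; $\mathbb{O}_2=\{t^\lambda s_1s_2,\ t^\lambda s_2s_1\mid\lambda\in Q\}$; for $i\in\mathbb{N}_+$, $\mathbb{C}_i=\{t^{k\alpha_1+i\alpha_2}s_1,\ t^{-i\alpha_1+k\alpha_2}s_2,\ t^{k\alpha_1+(k-i)\alpha_2}s_1s_2s_1\mid k\in\mathbb{Z}\}$ and $\mathbb{C}'_i=\{t^{k\alpha_1-i\alpha_2}s_1,\ t^{i\alpha_1+k\alpha_2}s_2,\ t^{(k-i)\alpha_1+k\alpha_2}s_1s_2s_1\mid k\in\mathbb{Z}\}$; $\mathbb{O}_{id,\tau}=\{t^{m\alpha_1+n\alpha_2}\tau,\ t^{m\alpha_1+n\alpha_2}s_1s_2\tau\mid m,n\in\mathbb{Z}\}$; for $i\in\mathbb{Z}$, $\mathbb{O}_{i,\tau}=\{t^{k\alpha_1+i\alpha_2}s_1s_2s_1\tau,\ t^{(k+i-1)\alpha_1+k\alpha_2}s_2\tau,\ t^{(1-i)\alpha_1+k\alpha_2}s_1\tau\mid k\in\mathbb{Z}\}$. *)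

(* Defs.v *)
From HB Require Import structures.
From mathcomp Require Import all_boot all_order all_algebra all_fingroup all_solvable all_field.
From mathcomp Require Import generic_quotient fraction.
From mathcomp Require Import boolp classical_sets.
From mathcomp Require Import zify.

Set Implicit Arguments.
Unset Strict Implicit.
Unset Printing Implicit Defensive.

Import GRing.Theory.

Local Open Scope ring_scope.
Local Open Scope quotient_scope.

Record fps (k : fieldType) := Fps { coef_fps :> nat -> k }.

Section FpsRing.
Variable k : fieldType.
Implicit Types f g h : fps k.

HB.instance Definition _ := [isNew for @coef_fps k].
HB.instance Definition _ := [Choice of fps k by <:].

Lemma fpsP f g : (forall n, f n = g n) <-> f = g.
Proof. by split=> [fg|->//]; apply: val_inj; apply/funext. Qed.

Definition fps0 : fps k := Fps (fun=> 0).
Definition fps1 : fps k := Fps (fun n => (n == 0%N)%:R).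
Definition add_fps f g := Fps (fun n => f n + g n).
Definition opp_fps f := Fps (fun n => - f n).
Definition mul_fps f g := Fps (fun n => \sum_(i < n.+1) f i * g (n - i)%N).

Let tp N f : {poly k} := \poly_(i < N) f i.

Let coef_tp N f n : (n < N)%N -> (tp N f)`_n = f n.
Proof. by move=> nN; rewrite coef_poly nN. Qed.

Let coef_mul_fps N f g n : (n < N)%N -> mul_fps f g n = (tp N f * tp N g)`_n.
Proof.
move=> nN; rewrite coefM /=; apply: eq_bigr => i _.
have := ltn_ord i; rewrite ltnS => lin.
by rewrite !coef_tp ?(leq_ltn_trans lin) // (leq_ltn_trans (leq_subr _ _)).
Qed.

Let coefM_congr N (p q r : {poly k}) n : (n < N)%N ->
  (forall m, (m < N)%N -> p`_m = q`_m) -> (r * p)`_n = (r * q)`_n.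
Proof.
move=> nN pq; rewrite !coefM; apply: eq_bigr => i _.
by rewrite pq // (leq_ltn_trans (leq_subr _ _)).
Qed.

Let mul_fpsC : commutative mul_fps.
Proof.
by move=> f g; apply/fpsP => n; rewrite !(@coef_mul_fps n.+1) // mulrC.
Qed.

Let mul_fpsA : associative mul_fps.
Proof.
move=> f g h; apply/fpsP => n; rewrite !(@coef_mul_fps n.+1) //.
have E u v m : (m < n.+1)%N ->
    (tp n.+1 (mul_fps u v))`_m = (tp n.+1 u * tp n.+1 v)`_m.
  by move=> mn; rewrite coef_tp // (@coef_mul_fps n.+1).
rewrite (coefM_congr _ _ (E g h)) // [in RHS](mulrC (tp n.+1 _)).
by rewrite (coefM_congr _ _ (E f g)) // mulrA [in RHS]mulrC.
Qed.

Let mul1_fps : left_id fps1 mul_fps.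
Proof.
move=> f; apply/fpsP => n /=; rewrite big_ord_recl /= mul1r subn0.
by rewrite big1 ?addr0 // => i _; rewrite mul0r.
Qed.

Let mul_fpsDl : left_distributive mul_fps add_fps.
Proof.
move=> f g h; apply/fpsP => n /=; rewrite -big_split; apply: eq_bigr => i _ /=.
by rewrite mulrDl.
Qed.

Let add_fpsA : associative add_fps.
Proof. by move=> f g h; apply/fpsP => n /=; rewrite addrA. Qed.
Let add_fpsC : commutative add_fps.
Proof. by move=> f g; apply/fpsP => n /=; rewrite addrC. Qed.
Let add0_fps : left_id fps0 add_fps.
Proof. by move=> f; apply/fpsP => n /=; rewrite add0r. Qed.
Let addN_fps : left_inverse fps0 opp_fps add_fps.
Proof. by move=> f; apply/fpsP => n /=; rewrite addNr. Qed.
Let fps1_neq0 : fps1 != fps0.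
Proof. by apply/eqP => /fpsP/(_ 0%N)/eqP; rewrite /= oner_eq0. Qed.

HB.instance Definition _ :=
  GRing.isZmodule.Build (fps k) add_fpsA add_fpsC add0_fps addN_fps.
HB.instance Definition _ := GRing.Zmodule_isComNzRing.Build (fps k)
  mul_fpsA mul_fpsC mul1_fps mul_fpsDl fps1_neq0.

Definition unit_fps f := `[< exists g, g * f = 1 >].
Definition inv_fps f : fps k :=
  if pselect (exists g, g * f = 1) is left fu then projT1 (cid fu) else f.

Let mulV_fps : {in unit_fps, left_inverse 1 inv_fps *%R}.
Proof.
move=> f /asboolP fu; rewrite /inv_fps; case: pselect => // fu'.
exact: (projT2 (cid fu')).
Qed.
Let unit_fpsPl f g : g * f = 1 -> unit_fps f.
Proof. by move=> gf; apply/asboolP; exists g. Qed.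
Let inv_fps_out : {in [predC unit_fps], inv_fps =1 id}.
Proof.
move=> f /asboolPn fu; rewrite /inv_fps; case: pselect => //.
Qed.

HB.instance Definition _ := GRing.ComNzRing_hasMulInverse.Build (fps k)
  mulV_fps unit_fpsPl inv_fps_out.

Let fps_idomain f g : f * g = 0 -> (f == 0) || (g == 0).
Proof.
have ord_ex h : h != 0 -> exists n, h n != 0.
  move=> h0; apply: contrapT => /forallNP hn; move/eqP: h0; apply.
  by apply/fpsP => n; apply/eqP/negPn/negP; apply: hn.
move=> fg0; apply: contraT; rewrite negb_or => /andP[/ord_ex fn /ord_ex gn].
case: (ex_minnP fn) => a fa amin; case: (ex_minnP gn) => b gb bmin.
have := (fpsP _ _).2 fg0 (a + b)%N => /=.
have aab : (a < (a + b).+1)%N by rewrite ltnS leq_addr.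
rewrite (bigD1 (Ordinal aab)) //= addKn big1 => [|i ia].
  by rewrite addr0 => /eqP; rewrite mulf_eq0 (negPf fa) (negPf gb).
have [lia|lai] := ltnP i a.
  have /eqP -> : f i == 0 by apply: contraLR lia => /amin; rewrite -leqNgt.
  by rewrite mul0r.
have {}lai : (a < i)%N by rewrite ltn_neqAle lai andbT eq_sym.
have /eqP -> : g (a + b - i)%N == 0; last by rewrite mulr0.
apply: contraT => /bmin; have := ltn_ord i; lia.
Qed.

HB.instance Definition _ :=
  GRing.ComUnitRing_isIntegral.Build (fps k) fps_idomain.

Definition epsO : fps k := Fps (fun n => (n == 1%N)%:R).

End FpsRing.

(* k((eps)), as the fraction field of k[[eps]]. *)
Notation laurent k := {fraction (fps k)}.
Notation "x %:L" := (FracField.tofrac x) (at level 2, format "x %:L").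

Definition eps (k : fieldType) : laurent k := (epsO k)%:L.

Section CoefficientwiseMaps.
Variables (k k' : fieldType) (phi : {rmorphism k -> k'}).

Definition map_fps (f : fps k) : fps k' := Fps (fun n => phi (f n)).

Let map_fps_zmod : zmod_morphism map_fps.
Proof. by move=> f g; apply/fpsP => n /=; rewrite rmorphB. Qed.

Let map_fps_monoid : monoid_morphism map_fps.
Proof.
split=> [|f g]; apply/fpsP => n /=; first by rewrite rmorph_nat.
by rewrite rmorph_sum; apply: eq_bigr => i _; rewrite rmorphM.
Qed.

HB.instance Definition _ :=
  GRing.isZmodMorphism.Build (fps k) (fps k') map_fps map_fps_zmod.
HB.instance Definition _ :=
  GRing.isMonoidMorphism.Build (fps k) (fps k') map_fps map_fps_monoid.

Lemma map_fps_eq0 f : (map_fps f == 0) = (f == 0).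
Proof.
apply/eqP/eqP => [/fpsP f0|->]; last exact: rmorph0.
by apply/fpsP => n; apply/eqP; rewrite -(fmorph_eq0 phi); apply/eqP/f0.
Qed.

Definition map_laurent (x : laurent k) : laurent k' :=
  (map_fps \n_(repr x))%:L / (map_fps \d_(repr x))%:L.

Lemma laurent_numden (x : laurent k) : x = (\n_(repr x))%:L / (\d_(repr x))%:L.
Proof.
have d0 : (\d_(repr x))%:L != 0 :> laurent k by rewrite tofrac_eq0 denom_ratioP.
apply: (mulIf d0); rewrite divfK //.
rewrite -{1}[x]reprK; move: (repr x) d0 => y d0; unlock FracField.tofrac.
rewrite -[LHS]FracField.pi_mul; apply/eqmodP.
rewrite /= FracField.equivfE /FracField.mulf /=.
rewrite !numden_Ratio ?oner_neq0 ?mulf_neq0 ?oner_neq0 ?denom_ratioP //.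
by rewrite !mulr1 mulrC.
Qed.

Lemma map_laurent_div (f g : fps k) : g != 0 ->
  map_laurent (f%:L / g%:L) = (map_fps f)%:L / (map_fps g)%:L.
Proof.
move=> g0; rewrite /map_laurent; move: (laurent_numden (f%:L / g%:L)).
set x := repr _.
move: (denom_ratioP x); move: (\n_x) (\d_x) => n d d0 /eqP.
rewrite eqr_div ?tofrac_eq0 // -!tofracM tofrac_eq => /eqP E.
apply/eqP; rewrite eqr_div ?tofrac_eq0 ?map_fps_eq0 //.
by rewrite -!tofracM -!rmorphM E.
Qed.

Let map_laurent_zmod : zmod_morphism map_laurent.
Proof.
move=> x y; rewrite [x]laurent_numden [y]laurent_numden.
move: (denom_ratioP (repr x)) (denom_ratioP (repr y)).
move: (\n_(repr x)) (\d_(repr x)) (\n_(repr y)) (\d_(repr y)) => a b c d b0 d0.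
rewrite -mulNr addf_div ?tofrac_eq0 // -tofracN -!tofracM -tofracD.
rewrite !map_laurent_div ?mulf_neq0 // -mulNr addf_div ?tofrac_eq0 ?map_fps_eq0 //.
by rewrite -tofracN -!tofracM -tofracD rmorphD !rmorphM rmorphN.
Qed.

Let map_laurent_monoid : monoid_morphism map_laurent.
Proof.
split=> [|x y].
  have E (F : fieldType) : 1 = 1%:L / 1%:L :> laurent F by rewrite tofrac1 divr1.
  by rewrite E map_laurent_div ?oner_neq0 // rmorph1 -E.
rewrite [x]laurent_numden [y]laurent_numden.
move: (denom_ratioP (repr x)) (denom_ratioP (repr y)).
move: (\n_(repr x)) (\d_(repr x)) (\n_(repr y)) (\d_(repr y)) => a b c d b0 d0.
rewrite mulf_div -!tofracM !map_laurent_div ?mulf_neq0 //.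
by rewrite mulf_div -!tofracM !rmorphM.
Qed.

HB.instance Definition _ := GRing.isZmodMorphism.Build
  (laurent k) (laurent k') map_laurent map_laurent_zmod.
HB.instance Definition _ := GRing.isMonoidMorphism.Build
  (laurent k) (laurent k') map_laurent map_laurent_monoid.

End CoefficientwiseMaps.

Section Frobenius.
Variables (Fq : finFieldType) (k : fieldType) (iota : {rmorphism Fq -> k}).

(* [iota] only serves to make this a ring morphism. *)
Definition frob of {rmorphism Fq -> k} := fun x : k => x ^+ #|Fq|.

Let card_pchar : [pchar k].-nat #|Fq|.
Proof.
have [p p_pr charFq] := finPcharP Fq.
rewrite (card_pprimeChar charFq : #|Fq| = _) pnatX; apply/orP; left.
by rewrite pnatE // (rmorph_pchar iota charFq).
Qed.

Let frob_zmod : zmod_morphism (frob iota).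
Proof. by move=> x y; rewrite /frob exprDn_pchar // exprNn_pchar. Qed.

Let frob_monoid : monoid_morphism (frob iota).
Proof. by split=> [|x y]; rewrite /frob ?expr1n ?exprMn. Qed.

HB.instance Definition _ := GRing.isZmodMorphism.Build k k (frob iota) frob_zmod.
HB.instance Definition _ :=
  GRing.isMonoidMorphism.Build k k (frob iota) frob_monoid.

End Frobenius.

Section ProjectiveLinearGroup.
Variables (n : nat) (F : fieldType).

Record GL := MkGL { gl_val :> 'M[F]_n; gl_unit : gl_val \in unitmx }.

HB.instance Definition _ := [isSub for gl_val].
HB.instance Definition _ := [Choice of GL by <:].

Implicit Types g h : GL.

Definition GL_one := MkGL (@unitmx1 F n).
Let GL_mul_unit g h : g *m h \in unitmx.
Proof. by rewrite unitmx_mul !gl_unit. Qed.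
Definition GL_mul g h := MkGL (GL_mul_unit g h).
Let GL_inv_unit g : invmx g \in unitmx.
Proof. by rewrite unitmx_inv gl_unit. Qed.
Definition GL_inv g := MkGL (GL_inv_unit g).

Let GL_mulA : associative GL_mul.
Proof. by move=> g h i; apply: val_inj; rewrite /= mulmxA. Qed.
Let GL_mul1g : left_id GL_one GL_mul.
Proof. by move=> g; apply: val_inj; rewrite /= mul1mx. Qed.
Let GL_mulg1 : right_id GL_one GL_mul.
Proof. by move=> g; apply: val_inj; rewrite /= mulmx1. Qed.
Let GL_mulVg : left_inverse GL_one GL_inv GL_mul.
Proof. by move=> g; apply: val_inj; rewrite /= mulVmx ?gl_unit. Qed.
Let GL_mulgV : right_inverse GL_one GL_inv GL_mul.
Proof. by move=> g; apply: val_inj; rewrite /= mulmxV ?gl_unit. Qed.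

HB.instance Definition _ := isGroup.Build GL
  GL_mulA GL_mul1g GL_mulg1 GL_mulVg GL_mulgV.

Definition proportional g h :=
  `[< exists2 c : F, c != 0 & gl_val g = c *: gl_val h >].

Let proportional_refl : reflexive proportional.
Proof. by move=> g; apply/asboolP; exists 1; rewrite ?oner_neq0 ?scale1r. Qed.
Let proportional_sym : symmetric proportional.
Proof.
move=> g h; apply/asboolP/asboolP => -[c c0 ->]; exists c^-1;
  by rewrite ?invr_neq0 // scalerA mulVf ?scale1r.
Qed.
Let proportional_trans : transitive proportional.
Proof.
move=> g h i /asboolP[c c0 hE] /asboolP[d d0 gE]; apply/asboolP; exists (c * d).
  by rewrite mulf_neq0.
by rewrite hE gE scalerA.
Qed.
Canonical proportional_equiv := EquivRel proportional
  proportional_refl proportional_sym proportional_trans.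

Definition PGL := {eq_quot proportional}.
HB.instance Definition _ := EqQuotient.on PGL.
HB.instance Definition _ := Choice.on PGL.

Definition PGL_class g : PGL := \pi_PGL g.

Lemma PGL_classP g h : reflect (exists2 c : F, c != 0 & gl_val g = c *: gl_val h)
  (PGL_class g == PGL_class h).
Proof. by rewrite /PGL_class eqmodE; apply: asboolP. Qed.

Definition PGL_one := PGL_class 1%g.
Definition PGL_mul (x y : PGL) := PGL_class (repr x * repr y)%g.
Definition PGL_inv (x : PGL) := PGL_class (repr x)^-1%g.

Let PGL_reprP g : exists2 c : F,
  c != 0 & gl_val (repr (PGL_class g)) = c *: gl_val g.
Proof. by apply/PGL_classP; rewrite /PGL_class reprK. Qed.

Lemma PGL_classM g h : PGL_class (g * h)%g = PGL_mul (PGL_class g) (PGL_class h).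
Proof.
have [c c0 gE] := PGL_reprP g; have [d d0 hE] := PGL_reprP h.
apply/esym/eqP/PGL_classP; exists (c * d); first by rewrite mulf_neq0.
by rewrite /= gE hE -scalemxAl -scalemxAr scalerA.
Qed.

Lemma PGL_classV g : PGL_class g^-1%g = PGL_inv (PGL_class g).
Proof.
have [c c0 gE] := PGL_reprP g.
apply/esym/eqP/PGL_classP; exists c^-1; first by rewrite invr_neq0.
by rewrite /= gE invmxZ ?unitmxZ ?unitfE ?gl_unit.
Qed.

Let PGL_ind (P : PGL -> Prop) : (forall g, P (PGL_class g)) -> forall x, P x.
Proof. by move=> Pg; elim/quotW => g; apply: Pg. Qed.

Let PGL_mulA : associative PGL_mul.
Proof.
elim/PGL_ind => g; elim/PGL_ind => h; elim/PGL_ind => i.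
by rewrite -!PGL_classM mulgA.
Qed.
Let PGL_mul1g : left_id PGL_one PGL_mul.
Proof. by elim/PGL_ind => g; rewrite -PGL_classM mul1g. Qed.
Let PGL_mulg1 : right_id PGL_one PGL_mul.
Proof. by elim/PGL_ind => g; rewrite -PGL_classM mulg1. Qed.
Let PGL_mulVg : left_inverse PGL_one PGL_inv PGL_mul.
Proof. by elim/PGL_ind => g; rewrite -PGL_classV -PGL_classM mulVg. Qed.
Let PGL_mulgV : right_inverse PGL_one PGL_inv PGL_mul.
Proof. by elim/PGL_ind => g; rewrite -PGL_classV -PGL_classM mulgV. Qed.

HB.instance Definition _ := isGroup.Build PGL
  PGL_mulA PGL_mul1g PGL_mulg1 PGL_mulVg PGL_mulgV.

End ProjectiveLinearGroup.

Section PGLMap.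
Variables (n : nat) (F F' : fieldType) (phi : {rmorphism F -> F'}).

Let map_GL_unit (g : GL n F) : map_mx phi g \in unitmx.
Proof. by rewrite map_unitmx gl_unit. Qed.
Definition map_GL (g : GL n F) := MkGL (map_GL_unit g).

Definition map_PGL (x : PGL n F) : PGL n F' := PGL_class (map_GL (repr x)).

Lemma map_PGL_class (g : GL n F) : map_PGL (PGL_class g) = PGL_class (map_GL g).
Proof.
have /PGL_classP[c c0 gE] : PGL_class (repr (PGL_class g)) == PGL_class g.
  by rewrite /PGL_class reprK.
apply/eqP/PGL_classP; exists (phi c); first by rewrite fmorph_eq0.
by rewrite /= gE map_mxZ.
Qed.

Lemma map_PGLM : {morph map_PGL : x y / (x * y)%g}.
Proof.
elim/quotW => g; elim/quotW => h.
rewrite -[LHS]/(map_PGL (PGL_class g * PGL_class h)%g).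
rewrite -[RHS]/(map_PGL (PGL_class g) * map_PGL (PGL_class h))%g.
rewrite -[X in map_PGL X]PGL_classM !map_PGL_class -[RHS]PGL_classM.
by congr PGL_class; apply: val_inj; rewrite /= map_mxM.
Qed.

End PGLMap.

(* A coweight [la] is given by its coordinates [(<la, alpha1>, <la, alpha2>)]
   in the basis of fundamental coweights. *)
Definition coweight := (int * int)%type.

Definition alpha1 : coweight := (2%:Z, - 1%:Z).
Definition alpha2 : coweight := (- 1%:Z, 2%:Z).
Definition omega1 : coweight := (1%:Z, 0%:Z).

Lemma omega1E : omega1 *+ 3 = alpha1 *+ 2 + alpha2.
Proof. by []. Qed.

(* The coweight lattice is Z^3 / Z(1,1,1); [cochar la] is the representative of
   [la] whose last coordinate vanishes. *)
Definition cochar (la : coweight) (i : 'I_3) : int :=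
  nth 0 [:: la.1 + la.2; la.2; 0] i.

Definition o0 : 'I_3 := inord 0.
Definition o1 : 'I_3 := inord 1.
Definition o2 : 'I_3 := inord 2.

Lemma ord3P (i : 'I_3) : [\/ i = o0, i = o1 | i = o2].
Proof.
by case: i => -[|[|[|//]]] lti; [constructor 1|constructor 2|constructor 3];
  apply: val_inj; rewrite /= inordK.
Qed.

(* The product of permutations in [perm] is [(w * v) i = v (w i)]; permuting
   coordinates as below is therefore a left action. *)
Definition wact (w : 'S_3) (la : coweight) : coweight :=
  (cochar la (w o0) - cochar la (w o1), cochar la (w o1) - cochar la (w o2)).

Lemma cochar_wact w la i :
  cochar (wact w la) i = cochar la (w i) - cochar la (w o2).
Proof.
case: (ord3P i) => ->.
- by rewrite {1}/cochar inordK //= addrA subrK.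
- by rewrite {1}/cochar inordK.
- by rewrite {1}/cochar inordK //= subrr.
Qed.

Lemma wactM w v la : wact (w * v)%g la = wact w (wact v la).
Proof.
rewrite {2}/wact !cochar_wact /wact !permM.
by congr pair; rewrite opprB addrA subrK.
Qed.

Lemma wact1 la : wact 1 la = la.
Proof.
case: la => a b; rewrite /wact !perm1 /cochar !inordK //= subr0.
by rewrite addrK.
Qed.

Lemma cocharD la mu i : cochar (la + mu) i = cochar la i + cochar mu i.
Proof.
case: i => -[|[|[|//]]] lti; rewrite /cochar //= ?addr0 //.
by rewrite addrACA.
Qed.

Lemma wactD w : {morph wact w : la mu / la + mu}.
Proof.
by move=> la mu; rewrite /wact !cocharD; congr pair; rewrite /= opprD addrACA.
Qed.

(* [IW la w] is the element [t^la w] of the semidirect product. *)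
Record iwgroup := IW { iw_trans : coweight; iw_fin : 'S_3 }.

Definition iw_pair x := (iw_trans x, iw_fin x).
Definition pair_iw p := IW p.1 p.2.
Lemma iw_pairK : cancel iw_pair pair_iw. Proof. by case. Qed.
HB.instance Definition _ := Choice.copy iwgroup (can_type iw_pairK).

Definition iw_one := IW 0 1%g.
Definition iw_mul x y :=
  IW (iw_trans x + wact (iw_fin x) (iw_trans y)) (iw_fin x * iw_fin y)%g.
Definition iw_inv x :=
  IW (- wact (iw_fin x)^-1%g (iw_trans x)) (iw_fin x)^-1%g.

Fact iw_mulA : associative iw_mul.
Proof.
by move=> x y z; rewrite /iw_mul /= wactD wactM addrA mulgA.
Qed.
Fact iw_mul1g : left_id iw_one iw_mul.
Proof. by case=> la w; rewrite /iw_mul /= wact1 add0r mul1g. Qed.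
Fact wact0 w : wact w 0 = 0.
Proof. by apply: (addrI (wact w 0)); rewrite -wactD !addr0. Qed.
Fact iw_mulg1 : right_id iw_one iw_mul.
Proof. by case=> la w; rewrite /iw_mul /= wact0 addr0 mulg1. Qed.
Fact wactN w la : wact w (- la) = - wact w la.
Proof. by apply: (addrI (wact w la)); rewrite -wactD !subrr wact0. Qed.
Fact iw_mulVg : left_inverse iw_one iw_inv iw_mul.
Proof. by case=> la w; rewrite /iw_mul /iw_inv /= addNr mulVg. Qed.
Fact iw_mulgV : right_inverse iw_one iw_inv iw_mul.
Proof.
case=> la w; rewrite /iw_mul /iw_inv /= wactN -wactM mulgV wact1.
by rewrite subrr.
Qed.
HB.instance Definition _ := isGroup.Build iwgroup
  iw_mulA iw_mul1g iw_mulg1 iw_mulVg iw_mulgV.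

Local Open Scope group_scope.

Definition t_ (la : coweight) : iwgroup := IW la 1.
Definition s1 : iwgroup := IW 0%R (tperm o0 o1).
Definition s2 : iwgroup := IW 0%R (tperm o1 o2).
Definition s0 : iwgroup := t_ (alpha1 + alpha2)%R * s1 * s2 * s1.
Definition tau : iwgroup := t_ omega1 * s1 * s2.

Lemma o01 : (o0 == o1) = false. Proof. by rewrite -val_eqE /= !inordK. Qed.
Lemma o02 : (o0 == o2) = false. Proof. by rewrite -val_eqE /= !inordK. Qed.
Lemma o12 : (o1 == o2) = false. Proof. by rewrite -val_eqE /= !inordK. Qed.

Definition eqo := (o01, o02, o12, eq_sym o1 o0, eq_sym o2 o0, eq_sym o2 o1, eqxx).
Lemma tp01_0 : tperm o0 o1 o0 = o1. Proof. exact: tpermL. Qed.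
Lemma tp01_1 : tperm o0 o1 o1 = o0. Proof. exact: tpermR. Qed.
Lemma tp01_2 : tperm o0 o1 o2 = o2. Proof. by rewrite tpermD // ?eqo. Qed.
Lemma tp12_0 : tperm o1 o2 o0 = o0. Proof. by rewrite tpermD // ?eqo. Qed.
Lemma tp12_1 : tperm o1 o2 o1 = o2. Proof. exact: tpermL. Qed.
Lemma tp12_2 : tperm o1 o2 o2 = o1. Proof. exact: tpermR. Qed.
Definition tpE := (tp01_0, tp01_1, tp01_2, tp12_0, tp12_1, tp12_2).

Lemma coweightMz (la : coweight) m : (la *~ m = (la.1 * m, la.2 * m))%R.
Proof.
rewrite [LHS]surjective_pairing -[(_ *~ _).1%R]/(fst (_ *~ _)%R).
by rewrite -[(_ *~ _).2%R]/(snd (_ *~ _)%R) !raddfMz /= !mulrzz.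
Qed.

Lemma wact_s1 la : wact (iw_fin s1) la = (la - alpha1 *~ la.1)%R.
Proof.
rewrite coweightMz; case: la => a b; rewrite /wact /= !tpE /cochar !inordK //=.
by rewrite -[RHS]/(_ - _, _ - _)%R /=; congr pair; lia.
Qed.

Lemma wact_s2 la : wact (iw_fin s2) la = (la - alpha2 *~ la.2)%R.
Proof.
rewrite coweightMz; case: la => a b; rewrite /wact /= !tpE /cochar !inordK //=.
by rewrite -[RHS]/(_ - _, _ - _)%R /=; congr pair; lia.
Qed.

Lemma iw_eqP x y : (iw_trans x).1 = (iw_trans y).1 ->
  (iw_trans x).2 = (iw_trans y).2 ->
  iw_fin x o0 = iw_fin y o0 -> iw_fin x o1 = iw_fin y o1 ->
  iw_fin x o2 = iw_fin y o2 -> x = y.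
Proof.
case: x y => [[a b] w] [[c d] v] /= -> -> e0 e1 e2; congr IW.
by apply/permP => i; case: (ord3P i) => ->.
Qed.

Local Ltac iw_eq := apply: iw_eqP; rewrite /= ?permM ?perm1 /= ?tpE //;
  rewrite /wact /cochar /= ?permM ?perm1 /= ?tpE ?inordK //=.

Lemma s1s1 : s1 * s1 = 1. Proof. by iw_eq. Qed.
Lemma s2s2 : s2 * s2 = 1. Proof. by iw_eq. Qed.
Lemma s0s0 : s0 * s0 = 1. Proof. by iw_eq. Qed.
Lemma tau3 : tau ^+ 3 = 1. Proof. by rewrite !expgS expg0 mulg1; iw_eq. Qed.
Lemma tau_s0 : tau * s0 = s1 * tau. Proof. by iw_eq. Qed.
Lemma tau_s1 : tau * s1 = s2 * tau. Proof. by iw_eq. Qed.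
Lemma tau_s2 : tau * s2 = s0 * tau. Proof. by iw_eq. Qed.
Lemma t_D la mu : t_ (la + mu)%R = t_ la * t_ mu.
Proof. by rewrite -[RHS]/(IW _ _) /= wact1 mulg1. Qed.

Definition refl (i : 'I_3) : iwgroup := nth 1 [:: s0; s1; s2] i.

Definition word (r : seq 'I_3) : iwgroup := foldr (fun i x => refl i * x) 1 r.

(* [x] is the product of [n] simple reflections of the Coxeter group W_a and of
   an element of Omega = <tau>. *)
Definition has_expr (x : iwgroup) (n : nat) :=
  `[< exists r j, size r = n /\ x = word r * tau ^+ j >].

Lemma has_exprP x : exists n, has_expr x n.
Proof.
pose P g := forall x, (exists n, has_expr x n) -> exists n, has_expr (g * x) n.
have Pr i : P (refl i).
  move=> y [n /asboolP[r [j [rn ->]]]]; exists n.+1; apply/asboolP.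
  by exists (i :: r), j; rewrite /= rn mulgA.
have Ptau : P tau.
  move=> y [n /asboolP[r [j [rn ->]]]]; exists n; apply/asboolP.
  exists (map (fun i : 'I_3 => nth o0 [:: o1; o2; o0] i) r), j.+1.
  rewrite size_map; split=> //.
  have shift : tau * word r =
      word (map (fun i : 'I_3 => nth o0 [:: o1; o2; o0] i) r) * tau.
    elim: r {n rn} => [|i r IHr]; first by rewrite /= mulg1 mul1g.
    rewrite [LHS](mulgA tau (refl i)) -[RHS](mulgA (refl _) _ tau) -IHr.
    rewrite [RHS](mulgA _ tau); congr (_ * _).
    by case: (ord3P i) => ->; rewrite /refl /= !inordK //= ?inordK //= ?tau_s0
      ?tau_s1 ?tau_s2.
  by rewrite [LHS](mulgA tau) shift expgS -[LHS]mulgA.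
have PM g h : P g -> P h -> P (g * h).
  by move=> Pg Ph y Sy; rewrite -mulgA; apply/Pg/Ph.
have P1 : P 1 by move=> y; rewrite mul1g.
have Ps1 : P s1 by have := Pr o1; rewrite /refl /= inordK.
have Ps2 : P s2 by have := Pr o2; rewrite /refl /= inordK.
have Pe1 : P (t_ (1, 0)%R).
  have -> : t_ (1, 0)%R = tau * s2 * s1 by iw_eq.
  by apply/PM/Ps1/PM.
have Pe2 : P (t_ (-1, 1)%R).
  have -> : t_ (-1, 1)%R = s1 * t_ (1, 0)%R * s1 by iw_eq.
  by apply/PM/Ps1/PM.
have Pe3 : P (t_ (0, -1)%R).
  have -> : t_ (0, -1)%R = s2 * t_ (-1, 1)%R * s2 by iw_eq.
  by apply/PM/Ps2/PM.
have Pn1 : P (t_ (-1, 0)%R).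
  have -> : t_ (-1, 0)%R = t_ (-1, 1)%R * t_ (0, -1)%R by rewrite -t_D.
  exact: PM.
have Pn3 : P (t_ (0, 1)%R).
  have -> : t_ (0, 1)%R = t_ (1, 0)%R * t_ (-1, 1)%R by rewrite -t_D.
  exact: PM.
have PX la n : P (t_ la) -> P (t_ (la *+ n)%R).
  move=> Pla; elim: n => [|n IHn]; first exact: P1.
  by rewrite mulrS t_D; apply: PM.
have PZ la (m : int) : P (t_ la) -> P (t_ (- la)%R) -> P (t_ (la *~ m)%R).
  case: m => n Pp Pn; first exact: PX.
  by rewrite NegzE mulrNz -mulNrz; apply: PX.
have Pt la : P (t_ la).
  have -> : la = ((1, 0) *~ la.1 + (0, 1) *~ la.2)%R.
    rewrite !coweightMz -[RHS]/(_ + _, _ + _)%R /=.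
    by rewrite !mul1r !mul0r addr0 add0r -surjective_pairing.
  rewrite t_D; apply: PM; apply: PZ => //.
pose Q w := P (IW 0%R w).
have QM v w : Q v -> Q w -> Q (v * w).
  move=> Qv Qw; have := PM _ _ Qv Qw.
  by rewrite -[IW _ _ * _]/(IW _ _) /= wact0 addr0.
have Q02 : Q (tperm o0 o2).
  have -> : tperm o0 o2 = tperm o0 o1 * tperm o1 o2 * tperm o0 o1.
    apply/permP => i; rewrite !permM.
    by case: (ord3P i) => ->; rewrite !tpE ?tpermL ?tpermR // tpermD ?eqo.
  exact: QM (QM _ _ Ps1 Ps2) Ps1.
have Qt i j : Q (tperm i j).
  case: (ord3P i) => ->; case: (ord3P j) => ->; rewrite ?tperm1 //;
    by [|rewrite tpermC].
have Qw w : Q w.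
  have [ts -> _] := prod_tpermP w.
  by elim: ts => [|p ts IHts]; rewrite ?big_nil ?big_cons //; apply: QM.
have : P x.
  have -> : x = t_ (iw_trans x) * IW 0%R (iw_fin x); last exact: PM (Pt _) (Qw _).
  case: x => la w; rewrite -[RHS]/(IW _ _) /= wact1 mul1g.
  by rewrite addr0.
move=> /(_ 1); rewrite mulg1; apply; exists 0%N; apply/asboolP.
by exists [::], 0%N; rewrite mulg1.
Qed.

(* For x = w tau^j with w in W_a this is the Coxeter length of w. *)
Definition len (x : iwgroup) : nat := ex_minn (has_exprP x).

Local Open Scope classical_set_scope.

Definition tQ (m n : int) : iwgroup := t_ (alpha1 *~ m + alpha2 *~ n)%R.

Definition O1 : set iwgroup := [set x | exists k : int,
  [\/ x = tQ k 0 * s1, x = tQ 0 k * s2 | x = tQ k k * s1 * s2 * s1]].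

Definition O2 : set iwgroup := [set x | exists m n : int,
  x = tQ m n * s1 * s2 \/ x = tQ m n * s2 * s1].

Definition Ci (i : int) : set iwgroup := [set x | exists k : int,
  [\/ x = tQ k i * s1, x = tQ (- i)%R k * s2
    | x = tQ k (k - i)%R * s1 * s2 * s1]].

Definition Ci' (i : int) : set iwgroup := [set x | exists k : int,
  [\/ x = tQ k (- i)%R * s1, x = tQ i k * s2
    | x = tQ (k - i)%R k * s1 * s2 * s1]].

Definition Oidtau : set iwgroup := [set x | exists m n : int,
  x = tQ m n * tau \/ x = tQ m n * s1 * s2 * tau].

Definition Oitau (i : int) : set iwgroup := [set x | exists k : int,
  [\/ x = tQ k i * s1 * s2 * s1 * tau, x = tQ (k + i - 1)%R k * s2 * tau
    | x = tQ (1 - i)%R k * s1 * tau]].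

Section AffineDeligneLusztig.
Variables (Fq : finFieldType) (k : fieldType) (iota : {rmorphism Fq -> k}).

Local Notation L := (laurent k).
Local Notation G := (PGL 3 L).

Definition sigma : G -> G := map_PGL (map_laurent (frob iota)).

(* The lift of [t^la w] with [t^la] sent to [eps^la]; it is fixed by sigma. *)
Definition iw_mx (x : iwgroup) : 'M[L]_3 :=
  diag_mx (\row_i (eps k ^ cochar (iw_trans x) i)%R) *m perm_mx (iw_fin x).

Lemma eps_neq0 : eps k != 0%R.
Proof.
rewrite tofrac_eq0; apply/eqP => /fpsP/(_ 1%N)/eqP.
by rewrite /= oner_eq0.
Qed.

Lemma iw_mx_unit x : iw_mx x \in unitmx.
Proof.
rewrite unitmx_mul unitmx_perm andbT unitmxE det_diag unitfE.
by apply/prodf_neq0 => i _; rewrite mxE expfz_neq0 // eps_neq0.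
Qed.

Definition iw_rep (x : iwgroup) : G := PGL_class (MkGL (iw_mx_unit x)).

Lemma iw_repM x y : iw_rep (x * y) = iw_rep x * iw_rep y.
Proof.
case: x y => [la w] [mu v]; rewrite /iw_rep -[RHS]PGL_classM.
apply/eqP/PGL_classP; exists (eps k ^ (- cochar mu (w o2)))%R.
  by rewrite expfz_neq0 // eps_neq0.
rewrite /= /iw_mx /=; apply/matrixP => i j.
have E (r : 'rV[L]_3) (u : 'S_3) i0 j0 :
    (diag_mx r *m perm_mx u) i0 j0 = (r 0 i0 * (u i0 == j0)%:R)%R.
  by rewrite mul_diag_mx !mxE.
have EM (r : 'rV[L]_3) (u : 'S_3) (A : 'M[L]_3) i0 j0 :
    (diag_mx r *m perm_mx u *m A) i0 j0 = (r 0 i0 * A (u i0) j0)%R.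
  by rewrite -mulmxA mul_diag_mx mxE -row_permE mxE.
rewrite [RHS]mxE E EM E !mxE permM /= cocharD cochar_wact !mulrA.
congr (_ * _)%R; rewrite -!expfzDr ?eps_neq0 //; congr (_ ^ _)%R.
by rewrite [LHS]addrA [LHS]addrC [LHS]addrA.
Qed.

(* The Iwahori subgroup of the base alcove 0 < alpha1, alpha2,
   alpha1 + alpha2 < 1.  As [t^la] is sent to [eps^la], it consists of the
   classes of the matrices of GL_3(k[[eps]]) that are lower (and not upper)
   triangular modulo eps: the affine reflection [s0] has entry [eps] in position
   (1, 3) and [eps^-1] in position (3, 1), and I U I s0 I is to be a group. *)
Definition iwahori : set G := [set x | exists g : GL 3 L, x = PGL_class g /\
  exists h : 'M[fps k]_3, [/\ h \in unitmx,
    forall i j : 'I_3, (i < j)%N -> h i j 0%N = 0%R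
    & gl_val g = map_mx (@FracField.tofrac (fps k)) h]].

Definition iwahori_double_coset (x : G) : set G :=
  [set y | exists i j, [/\ iwahori i, iwahori j & y = i * x * j]].

Definition ADLV (x : iwgroup) (b : G) : set (set G) :=
  [set gI | exists g : G, gI = [set g * i | i in iwahori] /\
    iwahori_double_coset (iw_rep x) (g^-1 * b * sigma g)].

End AffineDeligneLusztig.

(* Main.v *)
From HB Require Import structures.
Require Import Defs.
From mathcomp Require Import all_boot all_order all_algebra all_fingroup.
From mathcomp Require Import generic_quotient fraction.
From mathcomp Require Import boolp classical_sets.
From mathcomp Require Import zify.

(* If g^-1 b sigma(g) lies in I w I, then multiplying its Frobenius twists shows
   that g^-1 b^n sigma^n(g) is a product of n elements of I w I (b is fixed by
   sigma). Since b^3 = 1 in PGL_3, for 3 | n this is g^-1 sigma^n(g), whose entries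
   and determinant are bounded independently of n. When w is a nonzero
   translation, or t^la s1 (s1 exchanging coordinates 0 and 1) with the exponents
   of coordinates 0 and 1 both >= or both <= that of coordinate 2 and not balanced
   (their sum differs from twice the latter), then w or w^-1 can be scaled to be
   integral with nonzero entry (j,j) modulo eps and block triangular modulo eps
   like I; the products stay so while the valuation of their determinant grows
   linearly, a contradiction.
   Conversely, t^la w with w a 3-cycle is conjugate to s1 s2 or tau as soon as its
   Kottwitz invariant permits it, hence sigma-conjugate to b by an explicit
   instance of Lang's theorem; and if the exponents of t^la s1 lie strictly on
   both sides of that of coordinate 2, then I t^la s1 I contains the
   conjugate of such an element by a sigma-fixed one. Balanced elements t^la s1 are conjugate to s1. All
   other reflections are obtained from these by conjugation by tau, which normalises
   I. *)

Set Implicit Arguments.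
Unset Strict Implicit.
Unset Printing Implicit Defensive.

Import GRing.Theory Num.Theory Order.TTheory.

Local Open Scope ring_scope.
Local Open Scope quotient_scope.

(** * The length function of the Iwahori-Weyl group *)

Definition p1 : 'S_3 := tperm o0 o1.
Definition p2 : 'S_3 := tperm o1 o2.

Lemma perm3_eq (w v : 'S_3) : w o0 = v o0 -> w o1 = v o1 -> w = v.
Proof.
move=> e0 e1; apply/permP => i; case: (ord3P i) => -> //.
apply: (perm_inj (s := w^-1)%g); rewrite permK.
case: (ord3P (w^-1%g (v o2))) => e; rewrite e //; move: (congr1 w e);
  rewrite permKV ?e0 ?e1.
  by move/perm_inj/eqP; rewrite !eqo.
by move/perm_inj/eqP; rewrite !eqo.
Qed.

Lemma perm3_ind (P : 'S_3 -> Prop) :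
  P 1%g -> P p1 -> P p2 -> P (p1 * p2)%g -> P (p2 * p1)%g ->
  P (p1 * p2 * p1)%g -> forall w, P w.
Proof.
move=> P1 Pp1 Pp2 P12 P21 P121 w.
have : w o0 != w o1 by rewrite (inj_eq perm_inj) o01.
have E v : P v -> v o0 = w o0 -> v o1 = w o1 -> P w.
  by move=> Pv e0 e1; rewrite -(perm3_eq e0 e1).
case: (ord3P (w o0)) (ord3P (w o1)) => e0 [] e1;
  rewrite e0 e1 ?(eqxx, o01, o02, o12) // => _.
- by apply: E P1 _ _; rewrite !perm1.
- by apply: E Pp2 _ _; rewrite tpE.
- by apply: E Pp1 _ _; rewrite tpE.
- by apply: E P21 _ _; rewrite !permM !tpE.
- by apply: E P12 _ _; rewrite !permM !tpE.
- by apply: E P121 _ _; rewrite !permM !tpE.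
Qed.

(* Each summand counts the affine roots over one pair of coordinates that are
   positive for the Iwahori subgroup and made negative. *)
Definition alcove_length (x : iwgroup) : nat :=
  let a := (iw_trans x).1 in let b := (iw_trans x).2 in let w := iw_fin x in
  absz (a - (w o1 < w o0)%N%:Z)%R + absz (b - (w o2 < w o1)%N%:Z)%R
    + absz (a + b - (w o2 < w o0)%N%:Z)%R.

Lemma o0E : o0 = 0%N :> nat. Proof. exact: inordK. Qed.

Lemma o1E : o1 = 1%N :> nat. Proof. exact: inordK. Qed.

Lemma o2E : o2 = 2%N :> nat. Proof. exact: inordK. Qed.

Definition oE := (o0E, o1E, o2E).

Lemma s1M a b w : (s1 * IW (a, b) w = IW (- a, a + b) (p1 * w))%g.
Proof.
rewrite -[LHS]/(IW _ _) add0r wact_s1 coweightMz; congr IW.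
by rewrite -[LHS]/(_ - _, _ - _) /=; congr pair; lia.
Qed.

Lemma s2M a b w : (s2 * IW (a, b) w = IW (a + b, - b) (p2 * w))%g.
Proof.
rewrite -[LHS]/(IW _ _) add0r wact_s2 coweightMz; congr IW.
by rewrite -[LHS]/(_ - _, _ - _) /=; congr pair; lia.
Qed.

Lemma t_M la mu w : (t_ la * IW mu w = IW (la + mu) w)%g.
Proof. by rewrite -[LHS]/(IW _ _) /= wact1 mul1g. Qed.

Lemma cwD (a b c d : int) : (a, b) + (c, d) = (a + c, b + d) :> coweight.
Proof. by []. Qed.

Lemma s0M a b w : (s0 * IW (a, b) w = IW (1 - b, 1 - a) (p1 * p2 * p1 * w))%g.
Proof.
rewrite /s0 -2!mulgA s1M -mulgA s2M s1M t_M !mulgA cwD; congr IW.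
by congr pair; rewrite /=; lia.
Qed.

Lemma tauM a b w : (tau * IW (a, b) w = IW (1 - a - b, a) (p1 * p2 * w))%g.
Proof.
rewrite /tau -2!mulgA s2M s1M t_M !mulgA cwD; congr IW.
by congr pair; rewrite /=; lia.
Qed.

Lemma tauE : tau = IW (1, 0) (p1 * p2).
Proof. by rewrite -[LHS]mulg1 -[1%g]/(IW (0, 0) 1%g) tauM mulg1. Qed.

(** For each of the six permutations the comparisons become numerals, leaving linear arithmetic with
    absolute values. *)
Ltac alcove_length_lia w :=
  elim/perm3_ind: w; rewrite /alcove_length /= ?permM ?perm1 ?tpE ?oE; lia.

Lemma alcove_length_tauM x : alcove_length (tau * x)%g = alcove_length x.
Proof. by case: x => [[a b] w]; rewrite tauM; alcove_length_lia w. Qed.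

Lemma alcove_length_tauX j : alcove_length (tau ^+ j)%g = 0%N.
Proof.
elim: j => [|j IHj]; last by rewrite expgS alcove_length_tauM.
by rewrite expg0 /alcove_length /= !perm1 ?oE.
Qed.

Lemma alcove_length_reflM i x :
  (alcove_length (refl i * x)%g <= (alcove_length x).+1)%N.
Proof.
case: x => [[a b] w].
case: (ord3P i) => ->; rewrite /refl oE /= ?s0M ?s1M ?s2M; alcove_length_lia w.
Qed.

Lemma alcove_length_descent x : (0 < alcove_length x)%N ->
  exists i, (alcove_length (refl i * x)%g < alcove_length x)%N.
Proof.
case: x => [[a b] w] x_gt0.
suff : [|| alcove_length (s0 * IW (a, b) w)%g < alcove_length (IW (a, b) w),
           alcove_length (s1 * IW (a, b) w)%g < alcove_length (IW (a, b) w)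
         | alcove_length (s2 * IW (a, b) w)%g < alcove_length (IW (a, b) w)]%N.
  by case/or3P => lt; [exists o0|exists o1|exists o2]; rewrite /refl oE.
rewrite s0M s1M s2M; move: x_gt0; alcove_length_lia w.
Qed.

(** The stabiliser of the base alcove is Omega. *)
Lemma alcove_length_eq0 x : alcove_length x = 0%N -> exists j, x = (tau ^+ j)%g.
Proof.
case: x => [[a b] w].
elim/perm3_ind: w; rewrite /alcove_length /= ?permM ?perm1 ?tpE ?oE => eq0.
- exists 0%N; rewrite expg0; congr (IW (_, _) _); lia.
- lia.
- lia.
- by exists 1%N; rewrite expg1 tauE; congr (IW (_, _) _); lia.
- exists 2%N; rewrite expgS expg1 {2}tauE tauM.
  congr (IW (_, _) _); try lia.
  by apply: perm3_eq; rewrite !permM !tpE.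
- lia.
Qed.

(** A reflection raises [alcove_length] by at most one and powers of [tau] have value 0, so no
    expression is shorter; following descents down to a power of [tau] gives an expression of
    exactly that length. *)
Lemma lenE x : len x = alcove_length x.
Proof.
have min n : has_expr x n -> (alcove_length x <= n)%N.
  case/asboolP => r [j [<- ->]]; elim: r => [|i r IHr] /=.
    by rewrite mul1g alcove_length_tauX.
  by rewrite -mulgA (leq_trans (alcove_length_reflM _ _)).
have ex : has_expr x (alcove_length x).
  move: {2 3}(alcove_length x) (erefl (alcove_length x)) => n.
  elim: n x {min} => [|n IHn] x xn.
    case/alcove_length_eq0: xn => j ->.
    by apply/asboolP; exists [::], j; rewrite /= mul1g.
  have [|i] := @alcove_length_descent x; first by rewrite xn.
  have E : x = (refl i * (refl i * x))%g.
    rewrite mulgA; suff -> : (refl i * refl i = 1)%g by rewrite mul1g.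
    by case: (ord3P i) => ->; rewrite /refl oE /= ?s0s0 ?s1s1 ?s2s2.
  (* As [refl i] is an involution, the descent lowers the value by exactly one. *)
  move=> lt; have := alcove_length_reflM i (refl i * x); rewrite -E xn => ge.
  have /IHn/asboolP[r [j [rn rE]]] : alcove_length (refl i * x)%g = n by lia.
  by apply/asboolP; exists (i :: r), j; rewrite /= rn -mulgA -rE.
rewrite /len; case: ex_minnP => m /min xm mmin; apply/eqP.
by rewrite eqn_leq xm mmin.
Qed.

(** * Arithmetic form of the conditions of the theorem *)

(** The Cartan matrix of type A2 converts coordinates on the simple coroots into coordinates on the
    fundamental coweights. *)
Lemma tQE m n : tQ m n = IW (2 * m - n, 2 * n - m) 1.
Proof.
rewrite /tQ /t_ !coweightMz cwD; congr (IW (_, _) _); rewrite /=; lia.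
Qed.

Lemma IWM a b c d w v : (IW (a, b) w * IW (c, d) v =
  IW (a + (wact w (c, d)).1, b + (wact w (c, d)).2) (w * v))%g.
Proof. by []. Qed.

Lemma perm3_p2p1 : (p1 * p2 * (p1 * p2) = p2 * p1)%g.
Proof. by apply: perm3_eq; rewrite !permM !tpE. Qed.

Lemma tQ_s1 m n : (tQ m n * s1)%g = IW (2 * m - n, 2 * n - m) p1.
Proof. by rewrite tQE t_M addr0. Qed.

Lemma tQ_s2 m n : (tQ m n * s2)%g = IW (2 * m - n, 2 * n - m) p2.
Proof. by rewrite tQE t_M addr0. Qed.

Lemma tQ_s12 m n : (tQ m n * s1 * s2)%g = IW (2 * m - n, 2 * n - m) (p1 * p2).
Proof. by rewrite -mulgA s1M tQE t_M cwD; congr (IW (_, _) _); lia. Qed.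

Lemma tQ_s21 m n : (tQ m n * s2 * s1)%g = IW (2 * m - n, 2 * n - m) (p2 * p1).
Proof. by rewrite -mulgA s2M tQE t_M cwD; congr (IW (_, _) _); lia. Qed.

Lemma tQ_s121 m n :
  (tQ m n * s1 * s2 * s1)%g = IW (2 * m - n, 2 * n - m) (p1 * p2 * p1).
Proof.
by rewrite -2!mulgA s2M s1M tQE t_M cwD mulgA; congr (IW (_, _) _); lia.
Qed.

Lemma tQ_tau m n : (tQ m n * tau)%g = IW (2 * m - n + 1, 2 * n - m) (p1 * p2).
Proof. by rewrite tauE tQE t_M cwD; congr (IW (_, _) _); lia. Qed.

Lemma tQ_s12_tau m n :
  (tQ m n * s1 * s2 * tau)%g = IW (2 * m - n - 1, 2 * n - m + 1) (p2 * p1).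
Proof.
rewrite -2!mulgA tauE s2M s1M tQE t_M cwD mulgA perm3_p2p1.
by congr (IW (_, _) _); lia.
Qed.

Lemma tQ_s121_tau m n :
  (tQ m n * s1 * s2 * s1 * tau)%g = IW (2 * m - n, 2 * n - m - 1) p1.
Proof.
rewrite -(mulgA _ s1 tau) tauE s1M -(mulgA _ s2) s2M -(mulgA _ s1) s1M tQE t_M cwD.
congr (IW (_, _) _); try lia.
by apply: perm3_eq; rewrite !permM !tpE.
Qed.

Lemma tQ_s2_tau m n :
  (tQ m n * s2 * tau)%g = IW (2 * m - n + 1, 2 * n - m) (p1 * p2 * p1).
Proof.
rewrite -mulgA tauE s2M tQE t_M cwD; congr (IW (_, _) _); try lia.
by apply: perm3_eq; rewrite !permM !tpE.
Qed.

Lemma tQ_s1_tau m n :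
  (tQ m n * s1 * tau)%g = IW (2 * m - n - 1, 2 * n - m + 1) p2.
Proof.
rewrite -mulgA tauE s1M tQE t_M cwD; congr (IW (_, _) _); try lia.
by apply: perm3_eq; rewrite !permM !tpE.
Qed.

(* Distinguishes the six permutations by numerals that [lia] can compare. *)
Definition perm_code (w : 'S_3) : nat := (3 * w o0 + w o1)%N.

(* For [t^la s1], [a + b] and [b] are the exponents of coordinates 0 and 1 relative
   to that of coordinate 2, which [s1] fixes. *)
Definition opp_signs (a b : int) := (a + b < 0 < b) || (b < 0 < a + b).

Lemma coset_inv a b w c d v : IW (a, b) w = IW (c, d) v ->
  [/\ a = c, b = d & perm_code w = perm_code v].
Proof. by case=> -> -> ->. Qed.

Lemma perm_codeE :
  (perm_code 1 = 1) * (perm_code p1 = 3) * (perm_code p2 = 2)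
  * (perm_code (p1 * p2) = 6) * (perm_code (p2 * p1) = 5)
  * (perm_code (p1 * p2 * p1) = 7).
Proof. by rewrite /perm_code !permM !perm1 !tpE !oE. Qed.

Definition nonempty1 (w : iwgroup) :=
     w = 1%g \/
     (O1 w \/ O2 w) \/
     (exists i : nat, (0 < i)%N /\ (Ci i%:Z w \/ Ci' i%:Z w) /\
        (6 * i + 3 <= len w)%N).
Definition nonempty_tau w :=
     Oidtau w \/
     (exists i : nat, (0 < i)%N /\ Oitau i%:Z w /\ (6 * i - 1 <= len w)%N) \/
     (exists i : nat, (0 < i)%N /\ Oitau (1 - i%:Z)%R w /\
        (6 * i + 1 <= len w)%N).

Definition tQ_E := (tQ_s121_tau, tQ_s12_tau, tQ_s1_tau, tQ_s2_tau, tQ_tau,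
  tQ_s121, tQ_s12, tQ_s21, tQ_s1, tQ_s2).

Ltac len_simp := rewrite !lenE /alcove_length /= ?permM ?perm1 ?tpE ?oE.
Ltac nonempty1_lia := rewrite /nonempty1; len_simp;
  case=> [|[[[? []]|[? [? []]]]|[? [? [[] [? []]]]]]];
  rewrite ?tQ_E => /coset_inv[? ?]; rewrite !perm_codeE; lia.
Ltac IW_lia := rewrite ?tQ_E; congr (IW (_, _) _); lia.

(** Divisibility by 3 puts the coweight in the root lattice; the quotient is then the index of the
    class ([O1] for 0, [Ci'] for negative values). Away from index 0 the length bound amounts to
    [opp_signs]. *)
Definition p1_nonempty1 (a b : int) :=
  (3 %| a + 2 * b)%Z && ((a + 2 * b == 0) || opp_signs a b).

Lemma nonempty1_p1 a b : nonempty1 (IW (a, b) p1) <-> p1_nonempty1 a b.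
Proof.
rewrite /p1_nonempty1 /opp_signs; split; first by nonempty1_lia.
rewrite /nonempty1; len_simp => H; right.
have [eq0|neq0] := eqVneq (a + 2 * b) 0.
  by left; left; exists (- b); constructor 1; IW_lia.
right; exists (absz ((a + 2 * b) %/ 3)%Z);
do ![split; first by lia]; split; last by lia.
have [gt0|le0] := ltP 0 (a + 2 * b); [left|right].
all: by exists (a + b - ((a + 2 * b) %/ 3)%Z); constructor 1; IW_lia.
Qed.

(** [b] and [- a - b] are the coordinates of a [tau]-conjugate with finite part [s1], as in
    [tau_stable_p2]; the next lemma follows [tau_stable_p121] likewise. *)
Lemma nonempty1_p2 a b : nonempty1 (IW (a, b) p2) <-> p1_nonempty1 b (- a - b).
Proof.
rewrite /p1_nonempty1 /opp_signs; split; first by nonempty1_lia.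
rewrite /nonempty1; len_simp => H; right.
have [eq0|neq0] := eqVneq (2 * a + b) 0.
  by left; left; exists (- a); constructor 2; IW_lia.
(* With finite part [s2], membership in [Ci i] means [2 * a + b = - 3 * i], whence the reversed sign
   test below. *)
right; exists (absz ((2 * a + b) %/ 3)%Z);
do ![split; first by lia]; split; last by lia.
have [gt0|le0] := ltP (2 * a + b) 0; [left|right].
all: by exists (a + b - ((2 * a + b) %/ 3)%Z); constructor 2; IW_lia.
Qed.

Lemma nonempty1_p121 a b :
  nonempty1 (IW (a, b) (p1 * p2 * p1)) <-> p1_nonempty1 (2 - a - b) (a - 1).
Proof.
rewrite /p1_nonempty1 /opp_signs; split; first by nonempty1_lia.
rewrite /nonempty1; len_simp => H; right.
have [eq0|neq0] := eqVneq a b.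
  by left; left; exists a; constructor 3; IW_lia.
right; exists (absz ((a - b) %/ 3)%Z);
do ![split; first by lia]; split; last by lia.
have [gt0|le0] := ltP b a; [left|right].
  by exists (a - ((a - b) %/ 3)%Z); constructor 3; IW_lia.
by exists (a - 2 * ((a - b) %/ 3)%Z); constructor 3; IW_lia.
Qed.

Lemma nonempty1_p12 a b : nonempty1 (IW (a, b) (p1 * p2)) <-> (3 %| a + 2 * b)%Z.
Proof.
split; first by nonempty1_lia.
move=> H; right; left; right; pose t := ((a + 2 * b) %/ 3)%Z; exists (a + b - t), t.
by left; rewrite /t; IW_lia.
Qed.

Lemma nonempty1_p21 a b : nonempty1 (IW (a, b) (p2 * p1)) <-> (3 %| a + 2 * b)%Z.
Proof.
split; first by nonempty1_lia.
move=> H; right; left; right; pose t := ((a + 2 * b) %/ 3)%Z; exists (a + b - t), t.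
by right; rewrite /t; IW_lia.
Qed.

Lemma nonempty1_1 a b : nonempty1 (IW (a, b) 1) <-> (a == 0) && (b == 0).
Proof.
split; first by nonempty1_lia.
by case/andP => /eqP-> /eqP->; left.
Qed.

Ltac nonempty_tau_lia := rewrite /nonempty_tau; len_simp;
  case=> [[? [? []]]|[[? [? [[? []]]]]|[? [? [[? []]]]]]];
  rewrite ?tQ_E => /coset_inv[? ?]; rewrite !perm_codeE; lia.

(** The balanced case [a + 2 * b = 0] is excluded by the congruence. *)
Definition p1_nonempty_tau (a b : int) := (3 %| a + 2 * b - 1)%Z && opp_signs a b.

Lemma nonempty_tau_p1 a b : nonempty_tau (IW (a, b) p1) <-> p1_nonempty_tau a b.
Proof.
rewrite /p1_nonempty_tau /opp_signs; split; first by nonempty_tau_lia.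
rewrite /nonempty_tau; len_simp => H; right.
have [gt0|le0] := ltP 0 (a + 2 * b); [left|right].
  exists (absz ((a + 2 * b + 2) %/ 3)%Z); split; first by lia.
  split; last by lia.
  by exists (a + b - ((a + 2 * b - 1) %/ 3)%Z); constructor 1; IW_lia.
exists (absz ((a + 2 * b - 1) %/ 3)%Z); split; first by lia.
split; last by lia.
by exists (a + b - ((a + 2 * b - 1) %/ 3)%Z); constructor 1; IW_lia.
Qed.

Lemma nonempty_tau_p2 a b : nonempty_tau (IW (a, b) p2) <-> p1_nonempty_tau b (- a - b).
Proof.
rewrite /p1_nonempty_tau /opp_signs; split; first by nonempty_tau_lia.
(* [j] is the index of the class [Oitau j] of the element: positive indices belong to the first
   family, the others to the second with [i = 1 - j]. *)
rewrite /nonempty_tau; len_simp => H; right; pose j := ((2 - 2 * a - b) %/ 3)%Z.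
have [gt0|le0] := ltP 0 j; [left|right].
  exists (absz j); rewrite /j; do ![split; try lia].
  by exists (1 - 2 * j - a); constructor 3; rewrite /j; IW_lia.
exists (absz (1 - j)); rewrite /j; do ![split; try lia].
by exists (1 - 2 * j - a); constructor 3; rewrite /j; IW_lia.
Qed.

Lemma nonempty_tau_p121 a b :
  nonempty_tau (IW (a, b) (p1 * p2 * p1)) <-> p1_nonempty_tau (2 - a - b) (a - 1).
Proof.
rewrite /p1_nonempty_tau /opp_signs; split; first by nonempty_tau_lia.
rewrite /nonempty_tau; len_simp => H; right; pose j := ((a - b + 2) %/ 3)%Z.
have [gt0|le0] := ltP 0 j; [left|right].
  exists (absz j); rewrite /j; do ![split; try lia].
  by exists (b + j - 1); constructor 2; rewrite /j; IW_lia.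
exists (absz (1 - j)); rewrite /j; do ![split; try lia].
by exists (b + j - 1); constructor 2; rewrite /j; IW_lia.
Qed.

Lemma nonempty_tau_p12 a b :
  nonempty_tau (IW (a, b) (p1 * p2)) <-> (3 %| a + 2 * b - 1)%Z.
Proof.
split; first by nonempty_tau_lia.
move=> H; left; pose n := ((a + 2 * b - 1) %/ 3)%Z.
by exists (2 * n - b), n; left; rewrite /n; IW_lia.
Qed.

Lemma nonempty_tau_p21 a b :
  nonempty_tau (IW (a, b) (p2 * p1)) <-> (3 %| a + 2 * b - 1)%Z.
Proof.
split; first by nonempty_tau_lia.
move=> H; left; pose n := ((a + 2 * b - 1) %/ 3)%Z.
by exists (2 * n + 1 - b), n; right; rewrite /n; IW_lia.
Qed.

Lemma nonempty_tau_1 a b : ~ nonempty_tau (IW (a, b) 1).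
Proof. by nonempty_tau_lia. Qed.

(** * Reduction of all reflections to finite part [s1] *)

Section Reduction.
Variable N : set iwgroup.
Hypothesis N_tau : forall x y, (tau * x = y * tau)%g -> N x -> N y.

(** Conjugation by [tau] permutes the finite parts [s1], [s2], [s1 s2 s1] cyclically; going round
    the cycle turns the implication [N_tau] into the equivalences below. *)
Lemma tau_p1 a b : (tau * IW (a, b) p1 = IW (- a - b, a) p2 * tau)%g.
Proof.
rewrite tauM tauE IWM /wact /cochar /= !tpE !oE /=; congr (IW (_, _) _); try lia.
by apply: perm3_eq; rewrite !permM !tpE.
Qed.

Lemma tau_p2 a b : (tau * IW (a, b) p2 = IW (1 - a - b, 1 + a) (p1 * p2 * p1) * tau)%g.
Proof.
rewrite tauM tauE IWM /wact /cochar /= !permM !tpE !oE /=; congr (IW (_, _) _); try lia.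
by apply: perm3_eq; rewrite !permM !tpE.
Qed.

Lemma tau_p121 a b :
  (tau * IW (a, b) (p1 * p2 * p1) = IW (2 - a - b, a - 1) p1 * tau)%g.
Proof.
rewrite tauM tauE IWM /wact /cochar /= ?permM !tpE !oE /=; congr (IW (_, _) _); try lia.
by apply: perm3_eq; rewrite !permM !tpE.
Qed.

Lemma tau_stable_p2 a b : N (IW (a, b) p2) <-> N (IW (b, - a - b) p1).
Proof.
split.
  move/(N_tau (tau_p2 _ _))/(N_tau (tau_p121 _ _)).
  by congr (N (IW (_, _) _)); lia.
move/(N_tau (tau_p1 _ _)); congr (N (IW (_, _) _)); lia.
Qed.

Lemma tau_stable_p121 a b :
  N (IW (a, b) (p1 * p2 * p1)) <-> N (IW (2 - a - b, a - 1) p1).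
Proof.
split; first by move/(N_tau (tau_p121 _ _)).
move/(N_tau (tau_p1 _ _))/(N_tau (tau_p2 _ _)).
by congr (N (IW (_, _) _)); lia.
Qed.
End Reduction.

(** * The valuation of Laurent series *)

Section Valuation.
Variable k : fieldType.
Implicit Types (f g : fps k) (x y : laurent k).

(** The default value 0 at [f = 0] carries no meaning, and neither does [valuation] at 0; hence the
    nonvanishing hypotheses throughout. *)
Definition ord f : nat :=
  if pselect (exists n, f n != 0) is left f0 then ex_minn f0 else 0%N.

Lemma ord_eq f n : f n != 0 -> (forall m, (m < n)%N -> f m = 0) -> ord f = n.
Proof.
move=> fn f_lt; rewrite /ord; case: pselect => [f0|[]]; last by exists n.
case: ex_minnP => m fm m_min; apply/eqP; rewrite eqn_leq m_min //= leqNgt.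
by apply: contra fm => /f_lt ->.
Qed.

Lemma ordP f : f != 0 -> f (ord f) != 0 /\ forall m, (m < ord f)%N -> f m = 0.
Proof.
move=> f0; rewrite /ord; case: pselect => [f0'|nf0].
  case: ex_minnP => n fn n_min; split=> // m; apply: contraTeq => /n_min.
  by rewrite -leqNgt.
case/eqP: f0; apply/fpsP => n; apply: contrapT => /eqP fn.
by apply: nf0; exists n.
Qed.

Lemma coef_mul f g n : (f * g) n = \sum_(i < n.+1) f i * g (n - i)%N.
Proof. by []. Qed.

Lemma ordM f g : f != 0 -> g != 0 -> ord (f * g) = (ord f + ord g)%N.
Proof.
move=> /ordP[fn f_lt] /ordP[gn g_lt]; apply: ord_eq => [|m m_lt].
  have lt : (ord f < (ord f + ord g).+1)%N by rewrite ltnS leq_addr.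
  rewrite coef_mul (bigD1 (Ordinal lt)) //= addKn big1 ?addr0 ?mulf_neq0 // => i.
  rewrite -val_eqE /= => ni; have := ltn_ord i => lti.
  have [/f_lt->|le] := ltnP i (ord f); first by rewrite mul0r.
  by rewrite g_lt ?mulr0 //; lia.
rewrite coef_mul big1 // => i _; have := ltn_ord i => lti.
have [/f_lt->|le] := ltnP i (ord f); first by rewrite mul0r.
by rewrite g_lt ?mulr0 //; lia.
Qed.

Definition valuation x : int := (ord \n_(repr x))%:Z - (ord \d_(repr x))%:Z.

Lemma valuation_frac f g : f != 0 -> g != 0 ->
  valuation (f%:L / g%:L) = (ord f)%:Z - (ord g)%:Z.
Proof.
move=> f0 g0; rewrite /valuation; move: (laurent_numden (f%:L / g%:L)).
set x := repr _; have := denom_ratioP x; move: (\n_x) (\d_x) => n d d0 /eqP.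
rewrite eqr_div ?tofrac_eq0 // -!tofracM tofrac_eq => /eqP E.
have n0 : n != 0.
  by apply: contra_neq (mulf_neq0 f0 d0) => n0; rewrite E n0 mul0r.
have := congr1 ord E; rewrite !ordM //; lia.
Qed.

Lemma valuation_tofrac f : f != 0 -> valuation f%:L = (ord f)%:Z.
Proof.
move=> f0; rewrite -[f%:L]divr1 -tofrac1 valuation_frac ?oner_neq0 //.
by rewrite (@ord_eq 1 0%N) ?subr0 //= oner_neq0.
Qed.

Lemma laurentP x : x != 0 -> exists f g, [/\ f != 0, g != 0 & x = f%:L / g%:L].
Proof.
move=> x0; have E := laurent_numden x.
exists \n_(repr x), \d_(repr x); split; rewrite ?denom_ratioP //.
by apply: contra_neq x0 => n0; rewrite E n0 tofrac0 mul0r.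
Qed.

Lemma valuationM x y : x != 0 -> y != 0 ->
  valuation (x * y) = valuation x + valuation y.
Proof.
move=> /laurentP[a [b [a0 b0 ->]]] /laurentP[c [d [c0 d0 ->]]].
rewrite mulf_div -!tofracM !valuation_frac ?mulf_neq0 // !ordM //; lia.
Qed.

Lemma valuation1 : valuation 1 = 0.
Proof. by have := @valuationM 1 1 (oner_neq0 _) (oner_neq0 _); rewrite mulr1; lia. Qed.

Lemma valuationV x : x != 0 -> valuation x^-1 = - valuation x.
Proof.
move=> x0; have := @valuationM x x^-1 x0.
by rewrite invr_neq0 // divff // valuation1; lia.
Qed.

Lemma valuationX x n : x != 0 -> valuation (x ^+ n) = valuation x * n.
Proof.
move=> x0; elim: n => [|n IHn]; first by rewrite expr0 valuation1 mulr0.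
by rewrite exprS valuationM ?expf_neq0 //; lia.
Qed.

Lemma valuation_epsz (m : int) : valuation (eps k ^ m) = m.
Proof.
have e0 := eps_neq0 k; have v1 : valuation (eps k) = 1.
  rewrite valuation_tofrac; last by rewrite -tofrac_eq0 e0.
  by rewrite (@ord_eq _ 1%N) //= ?oner_neq0 // => -[].
case: m => n; rewrite ?NegzE ?exprzN ?valuationV ?expf_neq0 //.
all: by rewrite -?exprnP valuationX // v1; lia.
Qed.

Lemma ord_unit f : f \is a GRing.unit -> ord f = 0%N.
Proof.
move=> fu; have f0 : f != 0 by apply: contraTneq fu => ->; rewrite unitr0.
have g0 : f^-1 != 0 by rewrite invr_eq0.
have := @ordM f f^-1 f0 g0; rewrite divrr // (@ord_eq 1 0%N) //= ?oner_neq0 //.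
by case: (ord f).
Qed.
End Valuation.

Section ValuationMap.
Variables (k k' : fieldType) (phi : {rmorphism k -> k'}).
Lemma ord_map (f : fps k) : ord (map_fps phi f) = ord f.
Proof.
have [->|/ordP[fn f_lt]] := eqVneq f 0.
  rewrite rmorph0 /ord; case: pselect => [[n /eqP[]]|_] //.
  by case: pselect => [[n /eqP[]]|_].
by apply: ord_eq => [|m /f_lt /= ->]; rewrite /= ?fmorph_eq0 ?rmorph0.
Qed.

Lemma valuation_map (x : laurent k) : x != 0 ->
  valuation (map_laurent phi x) = valuation x.
Proof.
case/laurentP => f [g [f0 g0 ->]].
by rewrite map_laurent_div // !valuation_frac ?map_fps_eq0 // !ord_map.
Qed.

Lemma map_laurent_tofrac (f : fps k) : map_laurent phi f%:L = (map_fps phi f)%:L.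
Proof.
by rewrite -[f%:L]divr1 -tofrac1 map_laurent_div ?oner_neq0 // rmorph1 tofrac1 divr1.
Qed.
End ValuationMap.

(** * Boundedness *)

Section Blocks.
Variable k : fieldType.

Definition fps_eval0 (f : fps k) : k := f 0%N.
Fact fps_eval0_zmod : zmod_morphism fps_eval0.
Proof. by []. Qed.
Fact fps_eval0_monoid : monoid_morphism fps_eval0.
Proof. by split=> [|f g] //; rewrite /fps_eval0 coef_mul big_ord1. Qed.
HB.instance Definition _ := GRing.isZmodMorphism.Build _ _ fps_eval0 fps_eval0_zmod.
HB.instance Definition _ := GRing.isMonoidMorphism.Build _ _ fps_eval0 fps_eval0_monoid.

(* Modulo eps, [X] is lower triangular for the blocks [{< j}], [{j}] and [{> j}],
   so the [j]th diagonal entry is multiplicative. *)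
Definition block_lower (j : 'I_3) (X : 'M[fps k]_3) : Prop :=
  X j j 0%N != 0 /\
  forall i i' : 'I_3, (i <= j <= i')%N -> (i, i') != (j, j) -> X i i' 0%N = 0.

Lemma coef0_mulmx (X Y : 'M[fps k]_3) i i' :
  (X *m Y) i i' 0%N = \sum_l X i l 0%N * Y l i' 0%N.
Proof.
rewrite mxE -[LHS]/(fps_eval0 _) rmorph_sum; apply: eq_bigr => l _.
exact: rmorphM.
Qed.

(** An intermediate index other than [j] lies on one side of [j]: below it the entry of [Y] vanishes
    modulo eps, above it that of [X]. *)
Lemma block_lowerM j X Y : block_lower j X -> block_lower j Y -> block_lower j (X *m Y).
Proof.
move=> [Xj X0] [Yj Y0]; split=> [|i i' ij neq].
  rewrite coef0_mulmx (bigD1 j) //= big1 ?addr0 ?mulf_neq0 // => l lj.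
  case: (leqP l j) => [le|/ltnW le].
    by rewrite (Y0 l) ?mulr0 ?leqnn ?le // xpair_eqE (negPf lj).
  by rewrite X0 ?mul0r ?leqnn // xpair_eqE (negPf lj) andbF.
rewrite coef0_mulmx big1 // => l _; case/andP: ij => ij ji.
have [->|lj] := eqVneq l j.
  move: neq; rewrite xpair_eqE negb_and => /orP[nij|nij].
    by rewrite X0 ?mul0r ?ij ?leqnn // xpair_eqE (negPf nij).
  by rewrite (Y0 j) ?mulr0 ?ji ?leqnn // xpair_eqE (negPf nij) andbF.
case: (leqP l j) => [le|/ltnW le].
  by rewrite (Y0 l) ?mulr0 ?ji ?le // xpair_eqE (negPf lj).
by rewrite X0 ?mul0r ?ij ?le // xpair_eqE (negPf lj) andbF.
Qed.

Lemma block_lower1 j : block_lower j 1%:M.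
Proof.
split=> [|i i' ij neq]; rewrite !mxE ?eqxx ?oner_neq0 //.
case: eqP => // E; move: neq; rewrite -E xpair_eqE andbb -val_eqE /=.
by move: ij; rewrite -E => /anti_leq/val_inj->; rewrite eqxx.
Qed.

(** Modulo eps the determinant is the product of the diagonal entries and is nonzero. *)
Lemma block_lower_iwahori j (h : 'M[fps k]_3) : h \in unitmx ->
  (forall i j : 'I_3, (i < j)%N -> h i j 0%N = 0) -> block_lower j h.
Proof.
move=> hu h0; split=> [|i i' /andP[ij ji] neq].
  have : \det (map_mx fps_eval0 h) != 0.
    by rewrite det_map_mx -unitfE rmorph_unit // -unitmxE.
  rewrite det_trig => [/prodf_neq0/(_ j isT)|]; first by rewrite mxE.
  by apply/is_trig_mxP => i l il; rewrite mxE /fps_eval0 h0.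
apply: h0; move: neq; rewrite xpair_eqE -!val_eqE /=; lia.
Qed.
End Blocks.

(** * Bounds uniform in the Frobenius twists *)

Section Bound.
Variables (k : fieldType) (phi : {rmorphism k -> k}).
Notation L := (laurent k).
Notation sg := (map_laurent phi).
Notation sgO := (map_fps phi).
Notation lift := (map_mx (@FracField.tofrac (fps k))).

Lemma common_denominator n (A : 'M[L]_n) :
  exists D (A' : 'M[fps k]_n), D != 0 /\ D%:L *: A = lift A'.
Proof.
pose d (p : 'I_n * 'I_n) := \d_(repr (A p.1 p.2)).
exists (\prod_p d p).
exists (\matrix_(i, j) (\n_(repr (A i j)) * \prod_(p | p != (i, j)) d p)).
split; first by apply/prodf_neq0 => p _; rewrite denom_ratioP.
apply/matrixP => i j; rewrite !mxE (bigD1 (i, j)) //= -/(d _).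
rewrite [X in _ * X = _]laurent_numden !tofracM mulrAC [RHS]mulrC mulrC; congr (_ * _).
by rewrite mulrCA mulfV ?mulr1 // tofrac_eq0 denom_ratioP.
Qed.

Lemma iter_sgO_neq0 n D : D != 0 -> iter n sgO D != 0.
Proof.
move=> D0; elim: n => [|n IHn]; first exact: D0.
rewrite iterS map_fps_eq0; exact: IHn.
Qed.

Lemma ord_iter n D : ord (iter n sgO D) = ord D.
Proof. by elim: n => //= n IHn; rewrite ord_map. Qed.

Lemma iter_sg_neq0 n (x : L) : x != 0 -> iter n sg x != 0.
Proof.
move=> x0; elim: n => [|n IHn]; first exact: x0.
rewrite iterS fmorph_eq0; exact: IHn.
Qed.

Lemma valuation_iter n (x : L) : x != 0 -> valuation (iter n sg x) = valuation x.
Proof.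
move=> x0; elim: n => [|n IHn]; first by [].
by rewrite iterS valuation_map ?IHn; last exact: iter_sg_neq0.
Qed.

(** The twist of a denominator clears the twisted matrix, and by [ord_iter] its order does not
    depend on [n]. *)
Lemma iter_denominator m n D (A : 'M[L]_m) A' : D%:L *: A = lift A' ->
  (iter n sgO D)%:L *: iter n (map_mx sg) A = lift (iter n (map_mx sgO) A').
Proof.
move=> DA; elim: n => //= n IHn.
rewrite -map_laurent_tofrac -map_mxZ IHn -!map_mx_comp.
by apply: eq_map_mx => x /=; rewrite map_laurent_tofrac.
Qed.

Lemma det_iter m n (A : 'M[L]_m) : \det (iter n (map_mx sg) A) = iter n sg (\det A).
Proof. by elim: n => //= n IHn; rewrite det_map_mx IHn. Qed.

(** The determinant of [Y] has valuation three times that of [c] plus a constant, so it suffices to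
    bound the valuation of [c] from above; orders are invariant under twisting, so [K] is uniform in
    [m] and [n]. *)
Lemma ord_det_bounded (A B : 'M[L]_3) : \det A != 0 -> \det B != 0 ->
  exists K : nat, forall m n c j (Y : 'M[fps k]_3), c != 0 -> Y j j 0%N != 0 ->
   lift Y = c *: (iter m (map_mx sg) A *m iter n (map_mx sg) B) ->
   (ord (\det Y) <= K)%N.
Proof.
move=> A0 B0; have [D [A' [D0 DA]]] := common_denominator A.
have [E [B' [E0 EB]]] := common_denominator B.
exists (absz (3 * ((ord D)%:Z + (ord E)%:Z) + valuation (\det A) + valuation (\det B))).
move=> m n c j Y c0 Yj YE.
have detA : valuation (\det (iter m (map_mx sg) A)) = valuation (\det A).
  by rewrite det_iter (valuation_iter _ A0).
have detB : valuation (\det (iter n (map_mx sg) B)) = valuation (\det B).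
  by rewrite det_iter (valuation_iter _ B0).
have dA : \det (iter m (map_mx sg) A) != 0.
  by rewrite det_iter (iter_sg_neq0 _ A0).
have dB : \det (iter n (map_mx sg) B) != 0.
  by rewrite det_iter (iter_sg_neq0 _ B0).
have detY : (\det Y)%:L =
    c ^+ 3 * (\det (iter m (map_mx sg) A) * \det (iter n (map_mx sg) B)).
  by rewrite -det_mulmx -detZ -YE det_map_mx.
(* Clearing denominators in entry [(j, j)] equates a series of order [ord D + ord E], as [Y j j] has
   order 0, with [c] times a power series. *)
suff c_le : valuation c <= (ord D)%:Z + (ord E)%:Z.
  have dAB := mulf_neq0 dA dB; have c30 := expf_neq0 3 c0.
  have Y0 : \det Y != 0 by rewrite -tofrac_eq0 detY (mulf_neq0 c30 dAB).
  move/(congr1 (@valuation k)): detY.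
  rewrite (valuation_tofrac Y0) (valuationM c30 dAB) (valuationM dA dB).
  rewrite (valuationX _ c0) detA detB; move: c_le.
  move: (ord D) (ord E) (ord (\det Y)) (valuation c) (valuation (\det A)).
  move: (valuation (\det B)); clear; lia.
have [Z] : exists Z, lift ((iter m sgO D * iter n sgO E) *: Y) = c *: lift Z.
  exists (iter m (map_mx sgO) A' *m iter n (map_mx sgO) B').
  rewrite map_mxM -(iter_denominator _ DA) -(iter_denominator _ EB) map_mxZ YE.
  by rewrite -scalemxAl -scalemxAr !scalerA rmorphM mulrC mulrA.
move=> /matrixP/(_ j j); rewrite !mxE.
have Yjj : Y j j != 0 by apply: contraNneq Yj => ->.
have Dm := iter_sgO_neq0 m D0; have En := iter_sgO_neq0 n E0.
have DE := mulf_neq0 Dm En; have DEY := mulf_neq0 DE Yjj.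
have [->|Z0 /(congr1 (@valuation k))] := eqVneq (Z j j) 0.
  by rewrite tofrac0 mulr0 => /eqP; rewrite tofrac_eq0 (negPf DEY).
have LZ0 : (Z j j)%:L != 0 by rewrite tofrac_eq0.
rewrite (valuation_tofrac DEY) (ordM DE Yjj) (ordM Dm En).
rewrite (valuationM c0 LZ0).
rewrite (valuation_tofrac Z0).
rewrite !ord_iter (_ : ord (Y j j) = 0%N); last exact: ord_eq.
move: (ord D) (ord E) (ord (Z j j)) (valuation c); clear; lia.
Qed.
End Bound.

(** * Growth of twisted products *)

Section Growth.
Variables (k : fieldType) (phi : {rmorphism k -> k}).
Notation L := (laurent k).
Notation sg := (map_laurent phi).
Notation sgO := (map_fps phi).
Notation lift := (map_mx (@FracField.tofrac (fps k))).

Lemma map_lift m n (X : 'M[fps k]_(m, n)) :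
  map_mx sg (lift X) = lift (map_mx sgO X).
Proof.
by rewrite -!map_mx_comp; apply: eq_map_mx => x /=; rewrite map_laurent_tofrac.
Qed.

Variables (S : 'M[fps k]_3 -> Prop) (j : 'I_3).
Hypothesis S1 : S 1%:M.
Hypothesis SM : forall X Y, S X -> S Y -> S (X *m Y).
Hypothesis S_sg : forall X, S X -> S (map_mx sgO X).
Hypothesis Sj : forall X, S X -> X j j 0%N != 0.

(* The iterates of [M |-> B sigma(M)] send [G] to [sigma^n(G)], up to scalars, when 3
   divides n, but also to a multiple of [G Y] with [Y] the product of the twists
   of [X]; comparing valuations of determinants bounds that of [Y]. *)
Lemma no_growth (B G : 'M[L]_3) (e c : L) X : G \in unitmx -> \det B != 0 ->
  map_mx sg B = B -> B *m B *m B = e%:M -> e != 0 -> c != 0 -> S X ->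
  B *m map_mx sg G = c *: (G *m lift X) -> ord (\det X) = 0%N.
Proof.
move=> Gu B0 sB B3 e0 c0 SX E.
(* With [K] the bound on the order of the determinant, [3 * K.+1] iterations suffice to force order
   0 at each step. *)
have lin K o : (3 * K.+1 * o <= K)%N -> o = 0%N by clear; case: o => // o; lia.
have G0 : \det G != 0 by move: Gu; rewrite unitmxE unitfE.
have X0 : \det X != 0.
  have sG0 : sg (\det G) != 0 by rewrite fmorph_eq0 G0.
  apply: contra_neq (mulf_neq0 B0 sG0) => X0.
  by rewrite -det_map_mx -det_mulmx E detZ det_mulmx det_map_mx X0 rmorph0 !mulr0.
pose T (M : 'M[L]_3) := B *m map_mx sg M.
have TE n : exists (cn : L) (Y : 'M[fps k]_3), [/\ cn != 0, S Y, \det Y != 0,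
    ord (\det Y) = (n * ord (\det X))%N & iter n T G = cn *: (G *m lift Y)].
  elim: n => [|n [cn [Y [cn0 SY Y0 oY IHn]]]].
    exists 1, 1%:M; rewrite oner_neq0 det1 oner_neq0 map_mx1 mulmx1 scale1r.
    by rewrite (@ord_eq _ 1 0%N) //= oner_neq0.
  exists (sg cn * c), (X *m map_mx sgO Y).
  have csn0 : sg cn != 0 by rewrite fmorph_eq0 cn0.
  have sY0 : sgO (\det Y) != 0 by rewrite map_fps_eq0 Y0.
  split; first exact: mulf_neq0 csn0 c0.
  - exact: SM SX (S_sg SY).
  - by rewrite det_mulmx det_map_mx (mulf_neq0 X0 sY0).
  - by rewrite det_mulmx det_map_mx (ordM X0 sY0) ord_map oY.
  rewrite iterS IHn /T map_mxZ map_mxM -scalemxAr mulmxA E map_lift.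
  by rewrite -scalemxAl scalerA map_mxM mulmxA.
have T3 M : T (T (T M)) = e *: map_mx sg (map_mx sg (map_mx sg M)).
  by rewrite /T !map_mxM !sB !mulmxA B3 mul_scalar_mx.
have T3E m : exists2 em, em != 0 &
    iter (3 * m) T G = em *: iter (3 * m) (map_mx sg) G.
  elim: m => [|m [em em0 IHm]]; first by exists 1; rewrite ?oner_neq0 ?scale1r.
  exists (e * sg (sg (sg em))).
    by apply: (mulf_neq0 e0); rewrite !fmorph_eq0 em0.
  by rewrite mulnS !(iterD 3 (3 * m)) IHm /= T3 !map_mxZ scalerA.
have Gi0 : \det (invmx G) != 0 by rewrite det_inv invr_eq0 G0.
(* Up to a scalar, [Y] will be the untwisted inverse of [G] times a twist of [G]. *)
have [K KP] := ord_det_bounded phi Gi0 G0.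
have [em em0 emE] := T3E K.+1.
have [cn [Y [cn0 SY _ oY YE]]] := TE (3 * K.+1)%N.
have ci0 : cn^-1 != 0 by rewrite invr_eq0 cn0.
have := KP 0%N (3 * K.+1)%N (cn^-1 * em) j Y (mulf_neq0 ci0 em0) (Sj SY).
rewrite oY -scalerA scalemxAr -emE YE /= -scalemxAr scalerA (mulVf cn0).
rewrite scale1r (mulKmx Gu) => /(_ erefl)/lin; exact: id.
Qed.
End Growth.

(** * Iwahori subgroup and obstructions *)

Lemma sum3 (V : nmodType) (F : 'I_3 -> V) : \sum_i F i = F o0 + F o1 + F o2.
Proof.
rewrite !big_ord_recl big_ord0 addr0 addrA.
by congr (F _ + F _ + F _); apply: val_inj; rewrite /= ?oE.
Qed.

(** The diagonal entries of [T] are nonzero, so the vanishing is read off column by column from the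
    right. Applied modulo eps to inverses of Iwahori matrices. *)
Lemma lower_inv (F : fieldType) (M T : 'M[F]_3) : M *m T = 1%:M ->
  (forall i j : 'I_3, (i < j)%N -> T i j = 0) ->
  forall i j : 'I_3, (i < j)%N -> M i j = 0.
Proof.
move=> MT T0.
have Td i : T i i != 0.
  have : \det M * \det T != 0 by rewrite -det_mulmx MT det1 oner_neq0.
  rewrite mulf_eq0 negb_or => /andP[_]; rewrite det_trig; last exact/is_trig_mxP.
  by move/prodf_neq0 => /(_ i isT).
have E i j : M i o0 * T o0 j + M i o1 * T o1 j + M i o2 * T o2 j = (i == j)%:R.
  by move/matrixP: MT => /(_ i j); rewrite !mxE sum3.
have M2 i : i != o2 -> M i o2 = 0.
  move=> i2; have /eqP := E i o2; rewrite (T0 o0) ?(T0 o1) ?oE // !mulr0 !add0r.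
  by rewrite (negPf i2) mulf_eq0 (negPf (Td _)) orbF => /eqP.
have M01 : M o0 o1 = 0.
  have /eqP := E o0 o1; rewrite (T0 o0) ?oE // M2 ?eqo // mulr0 mul0r add0r addr0.
  by rewrite mulf_eq0 (negPf (Td _)) orbF => /eqP.
move=> i j; case: (ord3P i) => ->; case: (ord3P j) => ->; rewrite ?oE // => _.
- by rewrite M2 ?eqo.
- by rewrite M2 ?eqo.
Qed.

Section Iwahori.
Variable k : fieldType.
Notation L := (laurent k).
Notation lift := (map_mx (@FracField.tofrac (fps k))).

Definition iwahori_mx (h : 'M[fps k]_3) : Prop :=
  h \in unitmx /\ forall i j : 'I_3, (i < j)%N -> h i j 0%N = 0.

Lemma iwahori_mxV h : iwahori_mx h -> iwahori_mx (invmx h).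
Proof.
case=> hu h0; split; first by rewrite unitmx_inv.
move=> i j ij; have := @lower_inv k (map_mx (@fps_eval0 k) (invmx h)).
move=> /(_ (map_mx (@fps_eval0 k) h)).
rewrite -map_mxM mulVmx // map_mx1 => /(_ erefl) /(_ _ i j ij).
by rewrite mxE; apply=> i' j' ij'; rewrite mxE; apply: h0.
Qed.

Lemma block_lower_iwahori_mx j h : iwahori_mx h -> block_lower j h.
Proof. by case; apply: block_lower_iwahori. Qed.

Lemma PGL_classMg (g h : GL 3 L) :
  PGL_class (g * h)%g = (PGL_class g * PGL_class h)%g.
Proof. exact: PGL_classM. Qed.

Lemma PGL_surj (x : PGL 3 L) : exists g, x = PGL_class g.
Proof. by exists (repr x); rewrite /PGL_class reprK. Qed.

Lemma lift_unit n (h : 'M[fps k]_n) : h \in unitmx -> lift h \in unitmx.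
Proof. by move=> hu; rewrite !unitmxE det_map_mx rmorph_unit // -unitmxE. Qed.

Lemma valuation_det_lift n (h : 'M[fps k]_n) : h \in unitmx ->
  valuation (\det (lift h)) = 0.
Proof.
rewrite unitmxE => hu; rewrite det_map_mx valuation_tofrac ?ord_unit //.
by apply: contraTneq hu => ->; rewrite unitr0.
Qed.

Lemma unitmx_det n (G : 'M[L]_n) : G \in unitmx -> \det G != 0.
Proof. by rewrite unitmxE unitfE. Qed.

Lemma valuationN1 : valuation (-1 : L) = 0.
Proof.
have n1 : (-1 : L) != 0 by rewrite oppr_eq0 oner_neq0.
have := valuationM n1 n1; rewrite mulrNN mulr1 valuation1; clear; lia.
Qed.

(** The exponents [a + b], [b], [0] have sum [a + 2 * b]; modulo 3 this is the Kottwitz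
    invariant. *)
Lemma valuation_det_iw_mx x :
  valuation (\det (iw_mx k x)) = (iw_trans x).1 + 2 * (iw_trans x).2.
Proof.
have e0 (z : int) : eps k ^ z != 0 by rewrite expfz_neq0 // eps_neq0.
have n1 : (-1 : L) != 0 by rewrite oppr_eq0 oner_neq0.
rewrite det_mulmx det_diag det_perm.
set s := \prod_i _.
have -> : s = eps k ^ ((iw_trans x).1 + 2 * (iw_trans x).2).
  rewrite /s !big_ord_recl big_ord0 !mxE /cochar /= mulr1 expr0z mulr1.
  by rewrite -expfzDr ?eps_neq0 //; congr (_ ^ _); lia.
rewrite (valuationM (e0 _) (expf_neq0 _ n1)) valuation_epsz.
by rewrite (valuationX _ n1) valuationN1 mul0r addr0.
Qed.
End Iwahori.

Lemma ord_unitM (k : fieldType) (u f : fps k) : u \is a GRing.unit ->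
  ord (u * f) = ord f.
Proof.
move=> uu; have [->|f0] := eqVneq f 0; first by rewrite mulr0.
have u0 : u != 0 by apply: contraTneq uu => ->; rewrite unitr0.
by rewrite (ordM u0 f0) (ord_unit uu).
Qed.

Lemma ord_det_unit (k : fieldType) n (h1 h2 M : 'M[fps k]_n) :
  h1 \in unitmx -> h2 \in unitmx -> ord (\det (h1 *m M *m h2)) = ord (\det M).
Proof.
rewrite !unitmxE => u1 u2; rewrite !det_mulmx mulrC (ord_unitM _ u2).
by rewrite (ord_unitM _ u1).
Qed.

Section ScalarMatrixIdentities.
Variables (F : fieldType) (n : nat).
Implicit Types (A B G S W X Y H : 'M[F]_n) (c d e q : F).

Lemma scaled_cancel G H1 H1' H2 H2' W Y c d q :
  H1 *m H1' = 1%:M -> H2 *m H2' = 1%:M -> W *m Y = d%:M ->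
  c *: (G *m (H1 *m W *m H2)) *m (H2' *m (q *: Y) *m H1') = (q * d * c) *: G.
Proof.
move=> H1E H2E WY.
rewrite -scalemxAr -!scalemxAl -scalemxAr !mulmxA -(mulmxA _ H2) H2E mulmx1.
rewrite -(mulmxA _ W) WY mul_mx_scalar -!scalemxAl -(mulmxA _ H1) H1E mulmx1.
by rewrite !scalerA [c * _]mulrC.
Qed.

Lemma scaled_absorb G H1 H2 W c q r : q * r = 1 ->
  c *: (G *m (H1 *m W *m H2)) = (c * q) *: (G *m (H1 *m (r *: W) *m H2)).
Proof.
move=> qr; rewrite -scalemxAr -scalemxAl -scalemxAr scalerA.
by rewrite -mulrA qr mulr1.
Qed.

(** Inverse transposes turn a relation with [X] next to the twist [S] of [G] into the shape required
    by [no_growth], with [X] next to [G]. *)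
Lemma contragredient_twist B S G X c :
  B \in unitmx -> S \in unitmx -> G \in unitmx -> c != 0 ->
  B *m S *m X = c *: G ->
  (invmx B)^T *m (invmx S)^T = c^-1 *: ((invmx G)^T *m X^T).
Proof.
move=> Bu Su Gu c0 E; rewrite -!trmx_mul -linearZ /=; congr trmx.
have -> : X = c *: (invmx S *m invmx B *m G).
  by rewrite -mulmxA scalemxAr scalemxAr -E !mulmxA mulmxKV // mulVmx // mul1mx.
by rewrite -scalemxAl mulmxK // scalerA mulVf // scale1r.
Qed.

Lemma cube_contragredient B e : B \in unitmx -> e != 0 ->
  B *m B *m B = e%:M ->
  (invmx B)^T *m (invmx B)^T *m (invmx B)^T = (e^-1)%:M.
Proof.
move=> Bu e0 B3; rewrite -!trmx_mul -(tr_scalar_mx _ e^-1); congr trmx.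
have : invmx B *m (invmx B *m invmx B) *m (B *m B *m B) = 1%:M.
  by rewrite !mulmxA mulmxKV // mulmxKV // mulVmx.
rewrite B3 mul_mx_scalar => /(congr1 (fun M => e^-1 *: M)).
by rewrite scalerA mulVf // scale1r scalemx1.
Qed.
End ScalarMatrixIdentities.

(** * Obstructions to nonemptiness *)

Section Obstructions.
Variables (Fq : finFieldType) (k : fieldType) (iota : {rmorphism Fq -> k}).
Notation L := (laurent k).
Notation sg := (map_laurent (frob iota)).
Notation sgO := (map_fps (frob iota)).
Notation lift := (map_mx (@FracField.tofrac (fps k))).

Lemma ADLV_mx w (B : GL 3 L) : (ADLV iota w (PGL_class B) !=set0)%classic ->
  exists (G : 'M[L]_3) (c : L) h1 h2, [/\ G \in unitmx, c != 0,
    iwahori_mx h1, iwahori_mx h2 &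
    B *m map_mx sg G = c *: (G *m (lift h1 *m iw_mx k w *m lift h2))].
Proof.
case=> gI [g [_ [i [j [[I1 [-> [h1 [u1 h1_0 I1E]]]] [I2 [-> [h2 [u2 h2_0 I2E]]]] ]]]]].
have [G ->] := PGL_surj g.
rewrite /sigma map_PGL_class => E.
have /eqP/PGL_classP[c c0 cE] : PGL_class (B * map_GL sg G)%g =
    PGL_class (G * (I1 * MkGL (iw_mx_unit k w) * I2))%g.
  rewrite PGL_classMg [RHS]PGL_classMg (PGL_classMg (I1 * _)%g) (PGL_classMg I1).
  apply: (mulgI (PGL_class G)^-1%g); rewrite mulKg mulgA; exact: E.
exists G, c, h1, h2; split; [exact: gl_unit | exact: c0 | by [] | by [] |].
rewrite -I1E -I2E; exact: cE.
Qed.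

Variables (w : iwgroup) (B : GL 3 L) (e : L).
Hypothesis ne : (ADLV iota w (PGL_class B) !=set0)%classic.

(** Compare determinants: twisting preserves valuations, Iwahori matrices have unit determinant, and
    a scalar contributes a multiple of 3. *)
Lemma ADLV_deg : exists m : int, valuation (\det B) =
  3 * m + (iw_trans w).1 + 2 * (iw_trans w).2.
Proof.
have [G [c [h1 [h2 [Gu c0 [u1 _] [u2 _] E]]]]] := ADLV_mx ne.
exists (valuation c).
have G0 := unitmx_det Gu; have B0 := unitmx_det (gl_unit B).
have d1 := unitmx_det (lift_unit u1); have d2 := unitmx_det (lift_unit u2).
have W0 := unitmx_det (iw_mx_unit k w).
have sG0 : sg (\det G) != 0 by rewrite fmorph_eq0 G0.
have := congr1 (fun M => valuation (\det M)) E.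
rewrite det_mulmx det_map_mx (valuationM B0 sG0) (valuation_map _ G0).
have c3 := expf_neq0 3 c0; have d1W := mulf_neq0 d1 W0.
have X0 := mulf_neq0 d1W d2.
rewrite detZ (det_mulmx G) (det_mulmx (lift h1 *m _)) (det_mulmx (lift h1)).
rewrite (valuationM c3 (mulf_neq0 G0 X0)) (valuationM G0 X0).
rewrite (valuationM d1W d2) (valuationM d1 W0) (valuationX _ c0).
rewrite !valuation_det_lift ?u1 ?u2 // valuation_det_iw_mx.
move: (valuation (\det B)) (valuation (\det G)) (valuation c).
move: (iw_trans w).1 (iw_trans w).2; clear; lia.
Qed.

Hypotheses (sB : map_mx sg B = B) (B3 : B *m B *m B = e%:M) (e0 : e != 0).

(* Meaningful only when the [j]th exponent is minimal: [absz] drops the sign. *)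
Definition scaled_iw_mx (x : iwgroup) (j : 'I_3) : 'M[fps k]_3 :=
  \matrix_(i, l) (epsO k ^+ absz (cochar (iw_trans x) i - cochar (iw_trans x) j)%R
                  *+ (iw_fin x i == l)).

(** The first three clauses make [x], divided by the power of eps in row [j], integral and
    [block_lower] at [j]; the last one makes the determinant of the quotient a nonunit. *)
Definition contracting (x : iwgroup) (j : 'I_3) :=
  [/\ iw_fin x j = j,
      forall i : 'I_3, (i <= j <= iw_fin x i)%N -> i = j,
      forall i, cochar (iw_trans x) j <= cochar (iw_trans x) i &
      3 * cochar (iw_trans x) j != (iw_trans x).1 + 2 * (iw_trans x).2].

Lemma scaled_iw_mxE x j : contracting x j ->
  lift (scaled_iw_mx x j) = eps k ^ (- cochar (iw_trans x) j) *: iw_mx k x.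
Proof.
case=> _ _ c_ge _; apply/matrixP => i l.
rewrite /iw_mx mul_diag_mx !mxE rmorphMn rmorphXn /=.
rewrite mulrA -expfzDr ?eps_neq0 // mulr_natr; congr (_ *+ _).
rewrite -[X in X ^+ _ = _]/(eps k) exprnP gez0_abs ?subr_ge0 ?c_ge //.
by rewrite addrC.
Qed.

Lemma block_lower_scaled x j : contracting x j -> block_lower j (scaled_iw_mx x j).
Proof.
case=> wj w_lt c_ge _; split; first by rewrite mxE wj eqxx subrr /= oner_neq0.
move=> i l /andP[ij jl] neq; rewrite mxE; case: eqP => [E|]; last by rewrite mulr0n.
have ijE := w_lt i; rewrite E ij jl in ijE; have {}ijE := ijE isT.
by move: neq; rewrite -E ijE wj eqxx.
Qed.

Lemma scaled_det x j : contracting x j -> ord (\det (scaled_iw_mx x j)) != 0%N.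
Proof.
move=> xP; case: (xP) => _ _ _ neq.
have cX z : eps k ^ z != 0 by rewrite (expfz_neq0 _ (eps_neq0 k)).
have W0 := unitmx_det (iw_mx_unit k x).
have := congr1 determinant (scaled_iw_mxE xP).
rewrite det_map_mx detZ => E.
have d0 : \det (scaled_iw_mx x j) != 0.
  by rewrite -tofrac_eq0 E (mulf_neq0 (expf_neq0 3 (cX _)) W0).
have := congr1 (@valuation k) E.
rewrite (valuation_tofrac d0) (valuationM (expf_neq0 3 (cX _)) W0).
rewrite (valuationX _ (cX _)) valuation_epsz valuation_det_iw_mx.
move: neq; move: (ord _) (cochar _ _) (iw_trans x).1 (iw_trans x).2; clear.
by move=> n c a b; lia.
Qed.

Lemma block_lower_map j X : block_lower j X -> block_lower j (map_mx sgO X).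
Proof.
case=> Xj X0; split=> [|i l ij neq]; rewrite mxE /= ?fmorph_eq0 //.
by rewrite X0 // rmorph0.
Qed.

(** The scaling is absorbed into the scalar [c]; multiplying by Iwahori matrices keeps the matrix
    [block_lower] and the order of its determinant, contradicting [no_growth]. *)
Lemma ADLV_not_contracting j : ~ contracting w j.
Proof.
move=> wP; have [G [c [h1 [h2 [Gu c0 H1 H2 E]]]]] := ADLV_mx ne.
pose X := h1 *m scaled_iw_mx w j *m h2.
have bX : block_lower j X.
  apply/block_lowerM/(block_lower_iwahori_mx j H2).
  exact/block_lowerM/(block_lower_scaled wP)/(block_lower_iwahori_mx j H1).
have c'0 : c * eps k ^ (cochar (iw_trans w) j) != 0.
  by rewrite (mulf_neq0 c0 (expfz_neq0 _ (eps_neq0 k))).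
have B0 := unitmx_det (gl_unit B).
have XE : B *m map_mx sg G = (c * eps k ^ (cochar (iw_trans w) j)) *: (G *m lift X).
  rewrite E !map_mxM (scaled_iw_mxE wP); apply: scaled_absorb.
  by rewrite -(expfzDr _ _ (eps_neq0 k)) subrr expr0z.
have := no_growth (block_lower1 k j) (@block_lowerM k j) (@block_lower_map j)
  (fun X => @proj1 _ _) Gu B0 sB B3 e0 c'0 bX XE.
by rewrite (ord_det_unit _ H1.1 H2.1); apply/eqP/(scaled_det wP).
Qed.

(** Multiplying the relation on the right by the scaled [y] between inverse Iwahori matrices
    expresses [G] through its twist. Inverse transposes then restore the form of [no_growth], with
    [block_lower] imposed on transposes. *)
Lemma ADLV_not_contractingV y j : (w * y = 1)%g -> ~ contracting y j.
Proof.
move=> wy yP; have [G [c [h1 [h2 [Gu c0 H1 H2 E]]]]] := ADLV_mx ne.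
have [d d0 dE] : exists2 d, d != 0 & iw_mx k w *m iw_mx k y = d%:M.
  have /eqP/PGL_classP[d d0] :
      PGL_class (MkGL (iw_mx_unit k w) * MkGL (iw_mx_unit k y))%g =
      PGL_class (MkGL (iw_mx_unit k 1%g)).
    rewrite -[RHS]/(iw_rep k 1%g) -wy iw_repM; exact: PGL_classM.
  move=> dE; exists d; first exact: d0.
  rewrite -scalemx1; move: dE => /= ->; congr (_ *: _); rewrite /iw_mx perm_mx1 mulmx1.
  apply/matrixP => i l; rewrite !mxE.
  by case: (ord3P i) => ->; rewrite /cochar oE /= expr0z.
pose X := invmx h2 *m scaled_iw_mx y j *m invmx h1.
have H1' := iwahori_mxV H1; have H2' := iwahori_mxV H2.
have bX : block_lower j X.
  apply/block_lowerM/(block_lower_iwahori_mx j H1').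
  exact/block_lowerM/(block_lower_scaled yP)/(block_lower_iwahori_mx j H2').
pose q := eps k ^ (- cochar (iw_trans y) j).
have q0 : q != 0 by rewrite (expfz_neq0 _ (eps_neq0 k)).
pose c' := q * d * c.
have c'0 : c' != 0 by rewrite (mulf_neq0 (mulf_neq0 q0 d0) c0).
have B0 := unitmx_det (gl_unit B).
have sGu : map_mx sg G \in unitmx by rewrite map_unitmx Gu.
have lV h : h \in unitmx -> lift h *m lift (invmx h) = 1%:M.
  by move=> hu; rewrite -map_mxM mulmxV // map_mx1.
have XE : B *m map_mx sg G *m lift X = c' *: G.
  rewrite E !map_mxM (scaled_iw_mxE yP).
  exact: (scaled_cancel G c q (lV _ _ H1.1) (lV _ _ H2.1) dE).
have BT0 : \det (invmx B)^T != 0 by rewrite det_tr det_inv invr_eq0 B0.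
have GTu : (invmx G)^T \in unitmx by rewrite unitmx_tr unitmx_inv Gu.
have sBT : map_mx sg (invmx B)^T = (invmx B)^T by rewrite -map_trmx map_invmx sB.
have ei0 : e^-1 != 0 by rewrite invr_eq0 e0.
have ci0 : c'^-1 != 0 by rewrite invr_eq0 c'0.
have BT3 : (invmx B)^T *m (invmx B)^T *m (invmx B)^T = (e^-1)%:M.
  exact: cube_contragredient (gl_unit B) e0 B3.
have := contragredient_twist (gl_unit B) sGu Gu c'0 XE.
rewrite -map_invmx !map_trmx => XTE.
pose S (Y : 'M[fps k]_3) := block_lower j Y^T.
have S1 : S 1%:M by rewrite /S trmx1; apply: block_lower1.
have SM X1 X2 : S X1 -> S X2 -> S (X1 *m X2).
  by rewrite /S trmx_mul => S1' S2; apply: block_lowerM S2 S1'.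
have Ssg X1 : S X1 -> S (map_mx sgO X1) by rewrite /S map_trmx; apply: block_lower_map.
have Sj X1 : S X1 -> X1 j j 0%N != 0 by case; rewrite mxE.
have SX : S X^T by rewrite /S trmxK.
have := no_growth S1 SM Ssg Sj GTu BT0 sBT BT3 ei0 ci0 SX XTE.
rewrite det_tr (ord_det_unit _ H2'.1 H1'.1); apply/eqP/(scaled_det yP).
Qed.
End Obstructions.

(** * Nonemptiness *)

Section ExplicitMatrices.
Variable R : comNzRingType.
Definition mx3 (a b c d e f g h i : R) : 'M[R]_3 :=
  \matrix_(x, y) nth 0 (nth [::] [:: [:: a; b; c]; [:: d; e; f]; [:: g; h; i]] x) y.

Lemma mx3P (A : 'M[R]_3) : A = mx3 (A o0 o0) (A o0 o1) (A o0 o2)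
  (A o1 o0) (A o1 o1) (A o1 o2) (A o2 o0) (A o2 o1) (A o2 o2).
Proof.
by apply/matrixP => i j; case: (ord3P i) => ->; case: (ord3P j) => ->; rewrite !mxE !oE.
Qed.

Lemma mx3M a b c d e f g h i a' b' c' d' e' f' g' h' i' :
  mx3 a b c d e f g h i *m mx3 a' b' c' d' e' f' g' h' i' =
  mx3 (a * a' + b * d' + c * g') (a * b' + b * e' + c * h') (a * c' + b * f' + c * i')
      (d * a' + e * d' + f * g') (d * b' + e * e' + f * h') (d * c' + e * f' + f * i')
      (g * a' + h * d' + i * g') (g * b' + h * e' + i * h') (g * c' + h * f' + i * i').
Proof.
apply/matrixP => x y; rewrite mxE sum3 !mxE.
by case: (ord3P x) => ->; case: (ord3P y) => ->; rewrite !oE.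
Qed.

Lemma mx3_1 : 1%:M = mx3 1 0 0 0 1 0 0 0 1.
Proof. by rewrite [LHS]mx3P !mxE !eqo. Qed.
End ExplicitMatrices.

Lemma map_mx3 (R S : comNzRingType) (f : R -> S) a b c d e g h i j :
  map_mx f (mx3 a b c d e g h i j) =
  mx3 (f a) (f b) (f c) (f d) (f e) (f g) (f h) (f i) (f j).
Proof. by rewrite [LHS]mx3P !mxE !oE. Qed.

Section Monomial.
Variable k : fieldType.
Notation L := (laurent k).
Notation lift := (map_mx (@FracField.tofrac (fps k))).
Notation E z := (eps k ^ z).

Lemma iw_mxE x i j :
  iw_mx k x i j = E (cochar (iw_trans x) i) *+ (iw_fin x i == j).
Proof. by rewrite /iw_mx mul_diag_mx !mxE mulr_natr. Qed.

Lemma iw_mx_p1 a b : iw_mx k (IW (a, b) p1) = mx3 0 (E (a + b)) 0 (E b) 0 0 0 0 1.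
Proof. by rewrite [LHS]mx3P !iw_mxE /= !tpE !eqo /cochar !oE /= expr0z. Qed.

Lemma iw_mx_p2_0 : iw_mx k (IW 0 p2) = mx3 1 0 0 0 0 1 0 1 0.
Proof. by rewrite [LHS]mx3P !iw_mxE /= !tpE !eqo /cochar !oE /= expr0z. Qed.

Lemma iw_mx_p121_0 : iw_mx k (IW 0 (p1 * p2 * p1)) = mx3 0 0 1 0 1 0 1 0 0.
Proof. by rewrite [LHS]mx3P !iw_mxE /= !permM !tpE !eqo /cochar !oE /= expr0z. Qed.

Lemma iw_mx_tau : iw_mx k tau = mx3 0 0 (eps k) 1 0 0 0 1 0.
Proof.
by rewrite tauE [LHS]mx3P !iw_mxE /= !permM !tpE !eqo /cochar !oE /= expr0z expr1z.
Qed.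

Definition fps_shift (f : fps k) : fps k := Fps (fun n => f n.+1).
Lemma fps_shiftE (f : fps k) : f 0%N = 0 -> epsO k * fps_shift f = f.
Proof.
move=> f0; apply/fpsP => -[|n]; rewrite coef_mul.
  by rewrite big_ord1 f0 /= mul0r.
rewrite big_ord_recl big_ord_recl big1 /= => [|i _]; last by rewrite mul0r.
by rewrite mul0r add0r mul1r addr0 subn1.
Qed.

(** Conjugation by [tau] rotates the indices; the last column above the diagonal gets divided by
    eps, which is possible as it vanishes modulo eps, and the last row before the diagonal
    multiplied by it. *)
Lemma iwahori_mx_tau h : iwahori_mx h ->
  exists2 h', iwahori_mx h' & iw_mx k tau *m lift h = lift h' *m iw_mx k tau.
Proof.
case=> hu h0.
have h02 : h o0 o2 0%N = 0 by apply: h0; rewrite !oE.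
have h12 : h o1 o2 0%N = 0 by apply: h0; rewrite !oE.
have h01 : h o0 o1 0%N = 0 by apply: h0; rewrite !oE.
pose e := epsO k.
pose h' := mx3 (h o2 o2) (e * h o2 o0) (e * h o2 o1)
  (fps_shift (h o0 o2)) (h o0 o0) (h o0 o1) (fps_shift (h o1 o2)) (h o1 o0) (h o1 o1).
have hE : iw_mx k tau *m lift h = lift h' *m iw_mx k tau.
  rewrite iw_mx_tau [h in LHS]mx3P !map_mx3 !mx3M.
  rewrite !(mul0r, mulr0, add0r, addr0, mul1r, mulr1).
  have S (f : fps k) : f 0%N = 0 -> (fps_shift f)%:L * eps k = f%:L.
    by move=> f0; rewrite -tofracM mulrC fps_shiftE.
  by rewrite !S // !tofracM [eps k * (h o2 o2)%:L]mulrC.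
exists h' => //; split.
  have T0 := unitmx_det (iw_mx_unit k tau).
  have dE : \det (lift h) = \det (lift h').
    apply: (mulIf T0); rewrite mulrC; have := congr1 determinant hE.
    by rewrite !det_mulmx.
  move: dE hu; rewrite !det_map_mx !unitmxE => /eqP.
  by rewrite tofrac_eq => /eqP->.
move=> i j; case: (ord3P i) => ->; case: (ord3P j) => ->; rewrite ?oE // !mxE !oE //=.
- by rewrite big_ord1 mul0r.
- by rewrite big_ord1 mul0r.
Qed.

Lemma iwahori_mx_of_inv (h h' : 'M[fps k]_3) : h *m h' = 1%:M ->
  h o0 o1 0%N = 0 -> h o0 o2 0%N = 0 -> h o1 o2 0%N = 0 -> iwahori_mx h.
Proof.
move=> hh' h01 h02 h12; split; first by case: (mulmx1_unit hh').
by move=> i j; case: (ord3P i) => ->; case: (ord3P j) => ->; rewrite ?oE.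
Qed.

End Monomial.

Lemma conj_double_coset (gT : groupType) (g b s t i x j : gT) :
  (g^-1 * b * s = i * x * j ->
   t * g^-1 * b * (s * t^-1) = t * i * t^-1 * (t * x * t^-1) * (t * j * t^-1))%g.
Proof.
move=> E; rewrite !mulgA !mulgKV; congr (_ * _)%g.
by rewrite -(mulgA t g^-1)%g -(mulgA t (g^-1 * b))%g E !mulgA.
Qed.

(** * Sigma-conjugation and the action of [tau] *)

Section Twisting.
Variables (Fq : finFieldType) (k : fieldType) (iota : {rmorphism Fq -> k}).
Notation L := (laurent k).
Notation sg := (map_laurent (frob iota)).
Notation lift := (map_mx (@FracField.tofrac (fps k))).
Notation sigma := (sigma iota).
Implicit Types (b g : PGL 3 L) (w x y z : iwgroup).

Local Open Scope group_scope.

Lemma sigmaM g h : sigma (g * h) = sigma g * sigma h.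
Proof. exact: map_PGLM. Qed.

Lemma sigmaV g : sigma g^-1 = (sigma g)^-1.
Proof.
have s1 : sigma 1 = 1 by apply: (mulgI (sigma 1)); rewrite -sigmaM !mulg1.
by apply: (mulgI (sigma g)); rewrite -sigmaM !mulgV s1.
Qed.

Lemma map_eps : sg (eps k) = eps k.
Proof.
rewrite [LHS]map_laurent_tofrac; congr FracField.tofrac; apply/fpsP => n /=.
by rewrite rmorph_nat.
Qed.

Lemma map_iw_mx x : map_mx sg (iw_mx k x) = iw_mx k x.
Proof.
by apply/matrixP => i j; rewrite mxE iw_mxE rmorphMn fmorphXz /= map_eps.
Qed.

Lemma sigma_iw_rep x : sigma (iw_rep k x) = iw_rep k x.
Proof.
rewrite /Defs.sigma /iw_rep map_PGL_class; congr PGL_class; apply: val_inj.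
exact: map_iw_mx.
Qed.

Definition sigma_conj b b' := exists g, g^-1 * b * sigma g = b'.

(** For a sigma-fixed element, sigma-conjugation is ordinary conjugation. *)
Lemma sigma_conj_trans b b' g : sigma_conj b b' -> sigma g = g ->
  sigma_conj b (g^-1 * b' * g).
Proof.
case=> h <- sg; exists (h * g).
by rewrite sigmaM sg invMg !mulgA.
Qed.

Lemma ADLV_neP w b : (ADLV iota w b !=set0)%classic <->
  exists g, iwahori_double_coset (iw_rep k w) (g^-1 * b * sigma g).
Proof.
split=> [[_ [g [_ gP]]]|[g gP]]; first by exists g.
by exists [set g * i | i in @iwahori k]%classic, g.
Qed.

Lemma iwahori_class (h : 'M[fps k]_3) (hu : lift h \in unitmx) :
  iwahori_mx h -> iwahori (PGL_class (MkGL hu)).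
Proof. by case=> h1 h2; exists (MkGL hu); split=> //; exists h. Qed.

Lemma iwahori_tau i : iwahori i -> iwahori (iw_rep k tau * i * (iw_rep k tau)^-1).
Proof.
case=> I [-> [h [hu h0 IE]]].
have [h' h'I hE] := iwahori_mx_tau (conj hu h0).
have := iwahori_class (lift_unit h'I.1) h'I.
congr iwahori; apply: (mulIg (iw_rep k tau)); rewrite mulgKV.
rewrite /iw_rep -!PGL_classMg; congr PGL_class; apply: val_inj.
by rewrite /= IE hE.
Qed.

(** Replace [g] by [g tau^-1]: the representative of [tau] is sigma-fixed and normalises the
    Iwahori. *)
Lemma ADLV_tau b x y : tau * x = y * tau ->
  (ADLV iota x b !=set0)%classic -> (ADLV iota y b !=set0)%classic.
Proof.
move=> xy /ADLV_neP[g [i [j [iI jI E]]]]; apply/ADLV_neP.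
exists (g * (iw_rep k tau)^-1).
exists (iw_rep k tau * i * (iw_rep k tau)^-1), (iw_rep k tau * j * (iw_rep k tau)^-1).
split; [exact: iwahori_tau | exact: iwahori_tau |].
have yE : iw_rep k y = iw_rep k tau * iw_rep k x * (iw_rep k tau)^-1.
  by apply: (mulIg (iw_rep k tau)); rewrite mulgKV -!iw_repM xy.
rewrite yE sigmaM sigmaV sigma_iw_rep invMg invgK.
exact: conj_double_coset.
Qed.
End Twisting.

Section SigmaConjugation.
Variables (Fq : finFieldType) (k : fieldType) (iota : {rmorphism Fq -> k}).
Notation L := (laurent k).
Notation sg := (map_laurent (frob iota)).
Notation lift := (map_mx (@FracField.tofrac (fps k))).
Notation sigma := (sigma iota).
Notation sigma_conj := (sigma_conj iota).
Implicit Types (b g : PGL 3 L) (w x y z : iwgroup).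

Lemma sigma_conj_iw b x y z : (z * x = y * z)%g ->
  sigma_conj b (iw_rep k y) -> sigma_conj b (iw_rep k x).
Proof.
move=> zx /(sigma_conj_trans)/(_ (sigma_iw_rep iota z)); congr sigma_conj.
apply: (mulgI (iw_rep k z)).
by rewrite !mulgA mulgV mul1g -!iw_repM zx.
Qed.

Lemma iw_rep1 : iw_rep k 1%g = 1%g.
Proof. by apply: (mulgI (iw_rep k 1%g)); rewrite mulg1 -iw_repM mulg1. Qed.

Lemma iwahori1 : iwahori (1%g : PGL 3 L).
Proof.
exists 1%g; split=> //; exists 1%:M; split; first exact: unitmx1.
  by move=> i j ij; rewrite mxE -val_eqE ltn_eqF.
by rewrite map_mx1.
Qed.

Lemma ADLV_sigma_conj b w :
  sigma_conj b (iw_rep k w) -> (ADLV iota w b !=set0)%classic.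
Proof.
case=> g gE; apply/ADLV_neP; exists g; exists 1%g, 1%g.
by split; [exact: iwahori1|exact: iwahori1|rewrite gE mul1g mulg1].
Qed.

(** The equation places [g^-1 y w g] in the double coset of [w], and [g] being sigma-fixed, this
    conjugate is still sigma-conjugate to [b]. *)
Lemma ADLV_fixed_conj b y w (g : 'M[L]_3) (h1 h2 : 'M[fps k]_3) :
  sigma_conj b (iw_rep k (y * w)%g) -> g \in unitmx -> map_mx sg g = g ->
  iwahori_mx h1 -> iwahori_mx h2 ->
  iw_mx k y *m iw_mx k w *m g = g *m (lift h1 *m iw_mx k w *m lift h2) ->
  (ADLV iota w b !=set0)%classic.
Proof.
move=> bx gu sg_g H1 H2 E.
have sG : sigma (PGL_class (MkGL gu)) = PGL_class (MkGL gu).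
  by rewrite /Defs.sigma map_PGL_class; congr PGL_class; apply: val_inj.
have [h hE] := sigma_conj_trans bx sG.
apply/ADLV_neP; exists h.
exists (PGL_class (MkGL (lift_unit H1.1))), (PGL_class (MkGL (lift_unit H2.1))).
split; [exact: iwahori_class | exact: iwahori_class |].
rewrite hE; apply: (mulgI (PGL_class (MkGL gu))); rewrite mulgA mulKVg.
rewrite iw_repM /iw_rep -(PGL_classMg (MkGL (iw_mx_unit k y))).
rewrite -(PGL_classMg (_ * _)%g (MkGL gu)).
rewrite -(PGL_classMg _ (MkGL (iw_mx_unit k w))) -(PGL_classMg (_ * _)%g) -PGL_classMg.
by congr PGL_class; apply: val_inj.
Qed.

Lemma epsX_coef0 n : (0 < n)%N -> (epsO k ^+ n) 0%N = 0.
Proof. by case: n => // n _; rewrite exprS coef_mul big_ord1 mul0r. Qed.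

Lemma tofrac_epsX (z : int) : 0 <= z -> (epsO k ^+ absz z)%:L = eps k ^ z.
Proof. by move=> z0; rewrite tofracXn exprnP gez0_abs. Qed.

(* The matrix [g] below is [(1 + E20) P], [P] the permutation matrix of [(0 2)], and
   [(1 + E20) P = (1 + E02) j] with [j] lower triangular; as [w E02 w^-1] and
   [w^-1 E02 w] are multiples of [E12] lying in the Iwahori, [g^-1 P w g] lies
   in [I w I]. *)
Lemma ADLV_p1_neg_pos b (m n : int) : m + n < 0 < n ->
  sigma_conj b (iw_rep k (IW 0 (p1 * p2 * p1) * IW (m, n) p1)%g) ->
  (ADLV iota (IW (m, n) p1) b !=set0)%classic.
Proof.
case/andP=> mn n0 bx.
pose p := epsO k ^+ absz n; pose q := epsO k ^+ absz (- (m + n)).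
have pE : p%:L = eps k ^ n by rewrite tofrac_epsX // ltW.
have qE : q%:L * eps k ^ (m + n) = 1.
  by rewrite tofrac_epsX ?oppr_ge0 ?ltW // -expfzDr ?eps_neq0 // addNr expr0z.
have p0 : p 0%N = 0 by rewrite epsX_coef0 //; move: n0; clear; lia.
have q0 : q 0%N = 0 by rewrite epsX_coef0 //; move: mn; clear; lia.
pose g : 'M[L]_3 := mx3 0 0 1 0 1 0 1 0 1.
pose g' : 'M[L]_3 := mx3 (-1) 0 1 0 1 0 1 0 0.
have gu : g \in unitmx.
  have gg' : g *m g' = 1%:M.
    rewrite mx3M mx3_1.
    by rewrite !(mul0r, mulr0, add0r, addr0, mul1r, mulr1) addNr.
  exact: (mulmx1_unit gg').1.
(* [h1 = 1 + p E12] and [h2 = (1 - q E12) j], where [p E12 = w E02 w^-1] and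
   [q E12 = w^-1 E02 w]. *)
pose h1 := mx3 1 0 0 0 1 p 0 0 1.
pose h2 := mx3 (-1) 0 0 (- q) 1 (- q) 1 0 1.
apply: (@ADLV_fixed_conj b _ _ g h1 h2 bx gu).
- by rewrite map_mx3 rmorph0 rmorph1.
- apply: (@iwahori_mx_of_inv _ _ (mx3 1 0 0 0 1 (- p) 0 0 1)); rewrite ?mxE ?oE //.
  rewrite mx3M mx3_1.
  by rewrite !(mul0r, mulr0, add0r, addr0, mul1r, mulr1) addNr.
- apply: (@iwahori_mx_of_inv _ _ (mx3 (-1) 0 0 0 1 q 1 0 1)); rewrite ?mxE ?oE //=.
    rewrite mx3M mx3_1.
    rewrite !(mul0r, mulr0, add0r, addr0, mul1r, mulr1).
    by rewrite !(mulrN1, opprK, addNr, subrr).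
  by rewrite q0 oppr0.
rewrite iw_mx_p1 iw_mx_p121_0 !map_mx3 !mx3M rmorph0 rmorph1 !rmorphN rmorph1 /=.
rewrite !(mul0r, mulr0, add0r, addr0, mul1r, mulr1).
by rewrite pE mulrN1 addNr mulrN [_ * q%:L]mulrC qE addNr.
Qed.

(** The same argument with [P] the permutation matrix of [(1 2)] and
    [g = (1 + E21) P = (1 + E12) j]; the conjugates of [E12] by [w] and [w^-1] are now the multiples
    [p E02] and [q E02]. *)
Lemma ADLV_p1_pos_neg b (m n : int) : n < 0 < m + n ->
  sigma_conj b (iw_rep k (IW 0 p2 * IW (m, n) p1)%g) ->
  (ADLV iota (IW (m, n) p1) b !=set0)%classic.
Proof.
case/andP=> n0 mn bx.
pose p := epsO k ^+ absz (m + n); pose q := epsO k ^+ absz (- n).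
have pE : p%:L = eps k ^ (m + n) by rewrite tofrac_epsX // ltW.
have qE : q%:L * eps k ^ n = 1.
  by rewrite tofrac_epsX ?oppr_ge0 ?ltW // -expfzDr ?eps_neq0 // addNr expr0z.
have p0 : p 0%N = 0 by rewrite epsX_coef0 //; move: mn; clear; lia.
have q0 : q 0%N = 0 by rewrite epsX_coef0 //; move: n0; clear; lia.
pose g : 'M[L]_3 := mx3 1 0 0 0 0 1 0 1 1.
pose g' : 'M[L]_3 := mx3 1 0 0 0 (-1) 1 0 1 0.
have gu : g \in unitmx.
  have gg' : g *m g' = 1%:M.
    rewrite mx3M mx3_1.
    by rewrite !(mul0r, mulr0, add0r, addr0, mul1r, mulr1) addNr.
  exact: (mulmx1_unit gg').1.
pose h1 := mx3 1 0 p 0 1 0 0 0 1.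
pose h2 := mx3 1 (- q) (- q) 0 (-1) 0 0 1 1.
apply: (@ADLV_fixed_conj b _ _ g h1 h2 bx gu).
- by rewrite map_mx3 rmorph0 rmorph1.
- apply: (@iwahori_mx_of_inv _ _ (mx3 1 0 (- p) 0 1 0 0 0 1)); rewrite ?mxE ?oE //.
  rewrite mx3M mx3_1.
  by rewrite !(mul0r, mulr0, add0r, addr0, mul1r, mulr1) addNr.
- apply: (@iwahori_mx_of_inv _ _ (mx3 1 0 q 0 (-1) 0 0 1 1)); rewrite ?mxE ?oE //=.
  + rewrite mx3M mx3_1.
    rewrite !(mul0r, mulr0, add0r, addr0, mul1r, mulr1).
    by rewrite !(mulrN1, opprK, addNr, subrr).
  + by rewrite q0 oppr0.
  + by rewrite q0 oppr0.
rewrite iw_mx_p1 iw_mx_p2_0 !map_mx3 !mx3M rmorph0 rmorph1 !rmorphN rmorph1 /=.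
rewrite !(mul0r, mulr0, add0r, addr0, mul1r, mulr1).
by rewrite pE mulrN1 addNr mulrN [_ * q%:L]mulrC qE addNr.
Qed.

(* [V^-1 sigma(V)] permutes the columns of a Vandermonde matrix. *)
Lemma sigma_conj_perm (s : 'S_3) (a : 'I_3 -> k) : injective a ->
  (forall i, frob iota (a (s i)) = a i) -> sigma_conj 1%g (iw_rep k (IW 0 s)).
Proof.
move=> a_inj as_a.
pose V : 'M[fps k]_3 := \matrix_(i, j) Fps (fun n => a j ^+ i *+ (n == 0%N)).
have V0 : \det (lift V) != 0.
  rewrite det_map_mx tofrac_eq0;
  apply: contra_neq (_ : \det (Vandermonde 3 (\row_j a j)) != 0).
    move=> V0; rewrite (_ : Vandermonde _ _ = map_mx (@fps_eval0 k) V).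
      by rewrite det_map_mx V0 rmorph0.
    by apply/matrixP => i j; rewrite !mxE /fps_eval0 /= mulr1n.
  rewrite det_Vandermonde; apply/prodf_neq0 => i _; apply/prodf_neq0 => j ij.
  by rewrite !mxE subr_eq0 (inj_eq a_inj) -val_eqE gtn_eqF.
have Vu : lift V \in unitmx by rewrite unitmxE unitfE.
exists (PGL_class (MkGL Vu)).
rewrite mulg1; apply: (mulgI (PGL_class (MkGL Vu))); rewrite mulKVg.
rewrite /Defs.sigma map_PGL_class /iw_rep -(PGL_classMg (MkGL Vu)); congr PGL_class.
apply: val_inj => /=.
rewrite map_lift /iw_mx.
have -> : diag_mx (\row_i eps k ^ cochar 0 i) = 1%:M :> 'M[L]_3.
  apply/matrixP => i j; rewrite !mxE /cochar /=.
  by case: (ord3P i) => ->; rewrite oE /= ?addr0 expr0z.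
rewrite mul1mx -[s]invgK -col_permE.
apply/matrixP => i j; rewrite !mxE; congr FracField.tofrac; apply/fpsP => n /=.
rewrite rmorphMn rmorphXn /=; congr (_ ^+ _ *+ _).
by rewrite -{1}[j](permKV s) as_a.
Qed.
End SigmaConjugation.

(** * Explicit instances of Lang's theorem *)

Section Lang.
Variables (Fq : finFieldType) (k : closedFieldType) (iota : {rmorphism Fq -> k}).
Notation f := (frob iota).
Notation q := #|Fq|.

Lemma frobE x : f x = x ^+ q. Proof. by []. Qed.

(* If [f x = x + y], then [f^n x = x] as soon as [y + f y + ... + f^(n-1) y = 0]. *)
Lemma artin_schreier_root (y : k) : exists x, f x = x + y.
Proof.
have q1 : (1 < q)%N by exact: card_finNzRing_gt1.
have /closed_rootP[x] : size ('X^q - ('X + y%:P) : {poly k}) != 1%N.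
  by rewrite size_polyDl ?size_polyN ?size_XaddC ?size_polyXn; move: q1; clear; lia.
rewrite rootE !hornerE subr_eq0 => /eqP xE.
by exists x; rewrite frobE.
Qed.

(** A root of [X^(q-1) + 1], nonzero because of the constant term. *)
Lemma frob_trace0_2 : exists2 y : k, y != 0 & y + f y = 0.
Proof.
have q1 : (1 < q)%N by exact: card_finNzRing_gt1.
have q0 : (0 < q.-1)%N by move: q1; clear; lia.
have /closed_rootP[y] : size ('X^(q.-1) + 1%:P : {poly k}) != 1%N.
  by rewrite size_XnaddC // eqSS -lt0n.
rewrite rootE !hornerE addr_eq0 => /eqP yE; exists y.
  by apply: contra_eq_neq yE => ->; rewrite expr0n gtn_eqF // eq_sym oppr_eq0 oner_eq0.
by rewrite frobE -(prednK (ltnW q1)) exprS yE mulrN1 subrr.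
Qed.

(** A root of the trace polynomial [X + X^q + X^(q^2)] divided by [X], again nonzero because of the
    constant term. *)
Lemma frob_trace0_3 : exists2 y : k, y != 0 & y + f y + f (f y) = 0.
Proof.
have q1 : (1 < q)%N by exact: card_finNzRing_gt1.
have q0 : (0 < q.-1)%N by move: q1; clear; lia.
have qq : (q.-1 < (q * q).-1)%N by move: q1; clear; nia.
have sz : size ('X^(q.-1) + 1%:P : {poly k}) = q.
  by rewrite size_XnaddC // prednK // ltnW.
have /closed_rootP[y] : size ('X^((q * q).-1) + ('X^(q.-1) + 1%:P) : {poly k}) != 1%N.
  by rewrite size_polyDl ?sz ?size_polyXn; move: q1; clear; nia.
rewrite rootE !hornerE => /eqP yE; exists y.
  have qq0 := ltn_trans q0 qq.
  apply: contra_eq_neq yE => ->; rewrite !expr0n (gtn_eqF q0) (gtn_eqF qq0) /=.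
  by rewrite !mulr0n !add0r oner_neq0.
have := congr1 ( *%R y) yE; rewrite !mulrDr -!exprS !prednK ?(ltnW q1) //; last first.
  by move: q1; clear; nia.
by rewrite !frobE -exprM mulr1 mulr0 => <-; rewrite -addrA addrC [_ ^+ q + _]addrC.
Qed.

(** Frobenius exchanges the distinct points [x] and [f x] and fixes 0, which gives the Vandermonde
    nodes for the transposition. *)
Lemma sigma_conj1_s1 : sigma_conj iota 1%g (iw_rep k (IW 0 p1)).
Proof.
have [y y0 yE] := frob_trace0_2; have [x xE] := artin_schreier_root y.
have x_fx : x != f x by rewrite xE -subr_eq0 opprD addNKr oppr_eq0.
have x0 : x != 0 by apply: contra_neq x_fx => ->; rewrite rmorph0.
have fx0 : f x != 0 by rewrite fmorph_eq0.
have ffx : f (f x) = x by rewrite xE rmorphD /= xE -addrA yE addr0.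
apply: (@sigma_conj_perm _ _ _ _ (fun i : 'I_3 => nth 0 [:: x; f x; 0] i)).
  move=> i j; case: (ord3P i) => ->; case: (ord3P j) => ->; rewrite !oE //= => /eqP;
    by [rewrite ?(negPf x_fx) ?(negPf x0) ?(negPf fx0)
       |rewrite eq_sym ?(negPf x_fx) ?(negPf x0) ?(negPf fx0)].
by move=> i; case: (ord3P i) => ->; rewrite tpE !oE /= ?rmorph0.
Qed.

(** The nodes form a Frobenius orbit of exactly three points. *)
Lemma sigma_conj1_s1s2 : sigma_conj iota 1%g (iw_rep k (IW 0 (p1 * p2))).
Proof.
have [y y0 yE] := frob_trace0_3; have [x xE] := artin_schreier_root y.
have x_fx : x != f x by rewrite xE -subr_eq0 opprD addNKr oppr_eq0.
have fx_ffx : f x != f (f x) by rewrite (inj_eq (fmorph_inj _)).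
have ffxE : f (f x) = x + (y + f y) by rewrite [in f (f x)]xE rmorphD /= xE addrA.
have fffx : f (f (f x)) = x.
  by rewrite ffxE !rmorphD /= xE -addrA (addrA y) yE addr0.
have x_ffx : x != f (f x).
  rewrite -{1}fffx !(inj_eq (fmorph_inj _)) eq_sym.
  exact: x_fx.
apply: (@sigma_conj_perm _ _ _ _ (fun i : 'I_3 => nth 0 [:: x; f x; f (f x)] i)).
  move=> i j; case: (ord3P i) => ->; case: (ord3P j) => ->; rewrite !oE //= => /eqP;
    by [rewrite ?(negPf x_fx) ?(negPf x_ffx) ?(negPf fx_ffx)
       |rewrite eq_sym ?(negPf x_fx) ?(negPf x_ffx) ?(negPf fx_ffx)].
by move=> i; case: (ord3P i) => ->; rewrite !permM !tpE !oE /= ?fffx.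
Qed.
End Lang.

Section ThreeCycles.
Variables (Fq : finFieldType) (k : closedFieldType) (iota : {rmorphism Fq -> k}).

Lemma p12M m n a b v : (IW (m, n) (p1 * p2) * IW (a, b) v =
  IW (m - a - b, n + a) (p1 * p2 * v))%g.
Proof. by rewrite IWM /wact /cochar !permM !tpE !oE /=; congr (IW (_, _) _); lia. Qed.

Lemma p1M m n a b v : (IW (m, n) p1 * IW (a, b) v = IW (m - a, n + a + b) (p1 * v))%g.
Proof. by rewrite IWM /wact /cochar !tpE !oE /=; congr (IW (_, _) _); lia. Qed.

Lemma p2M m n a b v : (IW (m, n) p2 * IW (a, b) v = IW (m + a + b, n - b) (p2 * v))%g.
Proof. by rewrite IWM /wact /cochar !tpE !oE /=; congr (IW (_, _) _); lia. Qed.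

Lemma p121M m n a b v : (IW (m, n) (p1 * p2 * p1) * IW (a, b) v =
  IW (m - b, n - a) (p1 * p2 * p1 * v))%g.
Proof. by rewrite IWM /wact /cochar !permM !tpE !oE /=; congr (IW (_, _) _); lia. Qed.

Lemma t1M m n a b v : (IW (m, n) 1 * IW (a, b) v = IW (m + a, n + b) v)%g.
Proof. by rewrite IWM wact1 mul1g. Qed.

Variables (d : int) (b : PGL 3 (laurent k)).
Hypothesis bP : sigma_conj iota b (iw_rep k (IW (d, 0) (p1 * p2))).

(** Conjugation by [t^mu] shifts the coweight by [mu - c mu], with [c] the 3-cycle; these
    differences fill the root lattice, so only [m + 2 * n] modulo 3 matters. *)
Lemma sigma_conj_p12 m n : (3 %| m + 2 * n - d)%Z ->
  sigma_conj iota b (iw_rep k (IW (m, n) (p1 * p2))).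
Proof.
move=> mnd; pose u := ((d + n - m) %/ 3)%Z.
apply: (@sigma_conj_iw _ _ _ _ _ _ (IW (u, u - n) 1) _ bP).
rewrite t1M p12M mulg1; congr (IW (_, _) _); rewrite /u; move: mnd; clear; lia.
Qed.

Lemma sigma_conj_p21 m n : (3 %| m + 2 * n - d)%Z ->
  sigma_conj iota b (iw_rep k (IW (m, n) (p2 * p1))).
Proof.
(* The conjugating element has finite part [s1], which exchanges the two 3-cycles; [u] solves the
   remaining equation on coweights. *)
move=> mnd; pose u := ((d + 2 * m + n) %/ 3)%Z.
apply: (@sigma_conj_iw _ _ _ _ _ _ (IW (u, u - m - n) p1) _ bP).
rewrite p1M p12M mulgA; congr (IW (_, _) _); rewrite /u; move: mnd; clear; lia.
Qed.
End ThreeCycles.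

(** Take a coordinate of smallest exponent: as the exponents are not all equal, their sum exceeds
    three times the smallest. *)
Lemma contracting_translation m n : (m != 0) || (n != 0) ->
  exists j, contracting (IW (m, n) 1) j.
Proof.
move=> mn0.
have [le1|gt1] := leP 0 n; [have [le2|gt2] := leP 0 (m + n) |
  have [le2|gt2] := leP 0 m]; [exists o2|exists o0|exists o1|exists o0].
all: split=> /=; [by rewrite perm1
  | by move=> i; rewrite perm1 -eqn_leq => /eqP/val_inj
  | move=> i; case: (ord3P i) => ->; rewrite /cochar !oE /= | rewrite /cochar !oE /=].
all: lia.
Qed.

(** * Nonemptiness for both choices of [b] at once *)

Section Characterisation.
Variables (Fq : finFieldType) (k : closedFieldType) (iota : {rmorphism Fq -> k}).
Variables (B : GL 3 (laurent k)) (e : laurent k) (d : int).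
Notation b := (PGL_class B).
Notation N x := (ADLV iota x b !=set0)%classic.
Hypotheses (sB : map_mx (map_laurent (frob iota)) B = B).
Hypotheses (B3 : B *m B *m B = e%:M) (e0 : e != 0).
Hypothesis vB : valuation (\det B) = d.
Hypothesis bP : sigma_conj iota b (iw_rep k (IW (d, 0) (p1 * p2))).

Lemma ADLV_dvd3 m n v : N (IW (m, n) v) -> (3 %| m + 2 * n - d)%Z.
Proof. case/ADLV_deg => t; rewrite vB /=; clear; lia. Qed.

Lemma ADLV_translation m n : N (IW (m, n) 1) -> m = 0 /\ n = 0.
Proof.
move=> Nx; suff : ~ ((m != 0) || (n != 0)) by clear; lia.
move=> mn0.
have [j jP] := contracting_translation mn0.
exact: (ADLV_not_contracting Nx sB B3 e0 jP).
Qed.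

(** Coordinate 2 is fixed by [s1] and has exponent 0. Outside the balanced case, the element
    contracts there if the other exponents are nonnegative, its inverse if they are nonpositive. *)
Lemma ADLV_p1_signs m n : N (IW (m, n) p1) -> (m + 2 * n == 0) || opp_signs m n.
Proof.
move=> Nx.
have H1 : ~ [&& 0 <= m + n, 0 <= n & m + 2 * n != 0].
  move=> mn; apply: (ADLV_not_contracting Nx sB B3 e0 (j := o2)).
  split=> /=; first by rewrite tpE.
  - by move=> i; case: (ord3P i) => ->; rewrite tpE !oE.
  - by move=> i; case: (ord3P i) => ->; rewrite /cochar !oE /=; move: mn; clear; lia.
  by rewrite /cochar !oE /=; move: mn; clear; lia.
have H2 : ~ [&& m + n <= 0, n <= 0 & m + 2 * n != 0].
  move=> mn.
  have yx : (IW (m, n) p1 * IW (m, - m - n) p1 = 1)%g.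
    rewrite p1M -[RHS]/(IW (0, 0) 1);
    congr (IW (_, _) _); [by clear; lia|by clear; lia|].
    exact: tperm2.
  apply: (ADLV_not_contractingV Nx sB B3 e0 yx (j := o2)).
  split=> /=; first by rewrite tpE.
  - by move=> i; case: (ord3P i) => ->; rewrite tpE !oE.
  - by move=> i; case: (ord3P i) => ->; rewrite /cochar !oE /=; move: mn; clear; lia.
  by rewrite /cochar !oE /=; move: mn; clear; lia.
by rewrite /opp_signs; move: H1 H2; clear; lia.
Qed.

Lemma ADLV_p12 m n : N (IW (m, n) (p1 * p2)) <-> (3 %| m + 2 * n - d)%Z.
Proof.
by split=> [/ADLV_dvd3 //|mnd]; apply/ADLV_sigma_conj/(sigma_conj_p12 bP).
Qed.

Lemma ADLV_p21 m n : N (IW (m, n) (p2 * p1)) <-> (3 %| m + 2 * n - d)%Z.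
Proof.
by split=> [/ADLV_dvd3 //|mnd]; apply/ADLV_sigma_conj/(sigma_conj_p21 bP).
Qed.

(** Left multiplication by [s1 s2 s1] or [s2] gives a 3-cycle as finite part and leaves [m + 2 * n]
    unchanged modulo 3. *)
Lemma ADLV_p1_opp m n : (3 %| m + 2 * n - d)%Z -> opp_signs m n -> N (IW (m, n) p1).
Proof.
move=> mnd /orP[neg|pos].
  apply: (ADLV_p1_neg_pos neg); rewrite -[0]/(0, 0) p121M.
  rewrite -mulgA tperm2 mulg1; apply: (sigma_conj_p12 bP); move: mnd; clear; lia.
apply: (ADLV_p1_pos_neg pos); rewrite -[0]/(0, 0) p2M.
apply: (sigma_conj_p21 bP); move: mnd; clear; lia.
Qed.
End Characterisation.

Section Answers.
Variables (Fq : finFieldType) (k : closedFieldType) (iota : {rmorphism Fq -> k}).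
Notation sg := (map_laurent (frob iota)).

Lemma ADLV1_iff w : (ADLV iota w 1%g !=set0)%classic <-> nonempty1 w.
Proof.
pose B : GL 3 (laurent k) := 1%g.
have sB : map_mx sg B = B by rewrite map_mx1.
have B3 : B *m B *m B = 1%:M by rewrite !mulmx1.
have e0 : (1 : laurent k) != 0 by rewrite oner_neq0.
have vB : valuation (\det B) = 0 by rewrite det1 valuation1.
have bP := sigma_conj1_s1s2 iota.
have Ntau := @ADLV_tau _ _ iota 1%g.
have p1P m n : (ADLV iota (IW (m, n) p1) 1%g !=set0)%classic <-> p1_nonempty1 m n.
  split=> [Nx|].
    have := ADLV_dvd3 vB Nx; have := ADLV_p1_signs sB B3 e0 Nx.
    by rewrite /p1_nonempty1 subr0 => -> ->.
  case/andP=> deg /orP[/eqP mn|]; last by apply: (ADLV_p1_opp bP); rewrite subr0.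
  apply: ADLV_sigma_conj.
  (* In the balanced case [m = - 2 * n], this translation conjugates the element to [s1]. *)
  apply: (@sigma_conj_iw _ _ _ _ _ _ (IW (n, 0) 1)); last exact: sigma_conj1_s1.
  rewrite t1M [RHS](p1M 0 0) mulg1; congr (IW (_, _) _); move: mn; clear; lia.
case: w => [[m n] v]; elim/perm3_ind: v.
- rewrite nonempty1_1.
  split=> [/(ADLV_translation sB B3 e0)[-> ->] //|/andP[/eqP-> /eqP->]].
  apply: ADLV_sigma_conj; exists 1%g; rewrite mulg1 invg1 mul1g.
  rewrite -(iw_rep1 k).
  exact: sigma_iw_rep.
- by rewrite p1P nonempty1_p1.
- by rewrite (tau_stable_p2 Ntau) p1P nonempty1_p2.
- by rewrite nonempty1_p12 (ADLV_p12 vB bP) subr0.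
- by rewrite nonempty1_p21 (ADLV_p21 vB bP) subr0.
- by rewrite (tau_stable_p121 Ntau) p1P nonempty1_p121.
Qed.

Lemma ADLV_tau_iff w : (ADLV iota w (iw_rep k tau) !=set0)%classic <-> nonempty_tau w.
Proof.
pose B : GL 3 (laurent k) := MkGL (iw_mx_unit k tau).
have sB : map_mx sg B = B by exact: map_iw_mx.
have B3 : B *m B *m B = (eps k)%:M.
  rewrite -scalemx1 /B /= iw_mx_tau !mx3M !(mul0r, mulr0, add0r, addr0, mul1r, mulr1).
  rewrite mx3_1; apply/matrixP => i j; rewrite !mxE.
  by case: (ord3P i) => ->; case: (ord3P j) => ->; rewrite !oE /= ?mulr0 ?mulr1.
have e0 := eps_neq0 k.
have vB : valuation (\det B) = 1 by rewrite valuation_det_iw_mx tauE.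
have bP : sigma_conj iota (iw_rep k tau) (iw_rep k (IW (1, 0) (p1 * p2))).
  exists 1%g; rewrite -tauE invg1 mul1g.
  rewrite -(iw_rep1 k).
  by rewrite sigma_iw_rep -iw_repM mulg1.
have Ntau := @ADLV_tau _ _ iota (iw_rep k tau).
have p1P m n :
    (ADLV iota (IW (m, n) p1) (iw_rep k tau) !=set0)%classic <-> p1_nonempty_tau m n.
  split=> [Nx|]; last by case/andP; apply: (ADLV_p1_opp bP).
  have := ADLV_dvd3 vB Nx; have := ADLV_p1_signs sB B3 e0 Nx.
  by rewrite /p1_nonempty_tau; clear; lia.
case: w => [[m n] v]; elim/perm3_ind: v.
(* Only the identity survives among translations, and its Kottwitz invariant 0 differs from that of
   [tau]. *)
- split=> [Nx|/nonempty_tau_1 //]; have := ADLV_dvd3 vB Nx.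
  by have [-> ->] := ADLV_translation sB B3 e0 Nx.
- by rewrite p1P nonempty_tau_p1.
- by rewrite (tau_stable_p2 Ntau) p1P nonempty_tau_p2.
- by rewrite nonempty_tau_p12 (ADLV_p12 vB bP).
- by rewrite nonempty_tau_p21 (ADLV_p21 vB bP).
- by rewrite (tau_stable_p121 Ntau) p1P nonempty_tau_p121.
Qed.
End Answers.

Theorem theorem3p1 (Fq : finFieldType) (k : closedFieldType)
    (iota : {rmorphism Fq -> k})
    (k_algebraic : forall x : k, algebraicOver iota x) (w : iwgroup) :
  ((ADLV iota w 1%g !=set0)%classic <->
     w = 1%g \/
     (O1 w \/ O2 w) \/
     (exists i : nat, (0 < i)%N /\ (Ci i%:Z w \/ Ci' i%:Z w) /\
        (6 * i + 3 <= len w)%N)) /\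
  ((ADLV iota w (iw_rep k tau) !=set0)%classic <->
     Oidtau w \/
     (exists i : nat, (0 < i)%N /\ Oitau i%:Z w /\ (6 * i - 1 <= len w)%N) \/
     (exists i : nat, (0 < i)%N /\ Oitau (1 - i%:Z)%R w /\
        (6 * i + 1 <= len w)%N)).
Proof. by split; [exact: ADLV1_iff | exact: ADLV_tau_iff]. Qed.
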